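(* Let $R>0$, $\Psi=\{z\in\mathbb{C}:|\operatorname{Im}z|\le R\}$, and let $\{a_{m,n}\}_{m,n\in\mathbb{Z}_+}$ be a sequence of complex numbers. Define $$s_{m,n}=\frac{i^n}{2^{m+n}}\sum_{k=0}^m\sum_{j=0}^n(-1)^j\binom{m}{k}\binom{n}{j}a_{k+j,\,m-k+n-j},\qquad m,n\in\mathbb{Z}_+.$$ There exists a non-negative Borel measure $\sigma$ on $\Psi$ such that $$\int_\Psi z^m\overline{z}^n\,d\sigma=a_{m,n},\qquad m,n\in\mathbb{Z}_+,$$ if and only if for all complex numbers $\alpha_{m,n}$ ($m,n\in\mathbb{Z}_+$), all but finitely many equal to zero, $$\sum_{m,n,k,l=0}^\infty\alpha_{m,n}\overline{\alpha_{k,l}}\,s_{m+k,n+l}\ge0,$$ $$\sum_{m,n,k,l=0}^\infty\alpha_{m,n}\overline{\alpha_{k,l}}\,(R^2s_{m+k,n+l}-s_{m+k,n+l+2})\ge0,$$ and $$a_{m,n}=\sum_{r=0}^m\sum_{l=0}^n\binom{m}{r}\binom{n}{l}(-1)^{n-l}\,i^{\,m-r+n-l}\,s_{r+l,\,m-r+n-l},\qquad m,n\in\mathbb{Z}_+.$$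
   Context: $\mathbb{Z}_+$ denotes the set of non-negative integers. An inequality $c\ge0$ for a complex number $c$ means that $c$ is real and non-negative. The condition on $\sigma$ includes integrability of all $z^m\overline z^n$. *)

(* Defs.v *)
From HB Require Import structures.
From mathcomp Require Import all_boot all_order all_algebra.
From mathcomp Require Import complex.
From mathcomp Require Import all_classical all_reals all_analysis.

Set Implicit Arguments.
Unset Strict Implicit.
Unset Printing Implicit Defensive.

Import Order.TTheory GRing.Theory Num.Theory.
Import numFieldNormedType.Exports.

Local Open Scope classical_set_scope.
Local Open Scope ring_scope.
Local Open Scope complex_scope.

(* R[i] with its Borel sigma-algebra; R[i]^o carries the topology of the
   norm of R[i], that is, the usual topology of the complex plane. *)
Definition borelC (R : realType) :
    measurableType (sigma_display (@open R[i]^o)) :=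
  g_sigma_algebraType (@open R[i]^o).

Definition strip (R : realType) (r : R) : set R[i] :=
  [set z | `|complex.Im z| <= r].

Definition cintegrable d (T : measurableType d) (R : realType)
    (mu : {measure set T -> \bar R}) (D : set T) (f : T -> R[i]) : Prop :=
  mu.-integrable D (fun x => (complex.Re (f x))%:E) /\
  mu.-integrable D (fun x => (complex.Im (f x))%:E).

Definition cintegral d (T : measurableType d) (R : realType)
    (mu : {measure set T -> \bar R}) (D : set T) (f : T -> R[i]) : R[i] :=
  (\int[mu]_(x in D) complex.Re (f x)) +i* (\int[mu]_(x in D) complex.Im (f x)).

Definition monoC (R : realType) (m n : nat) (z : R[i]) : R[i] :=
  z ^+ m * conjc z ^+ n.

(* A Borel measure on the strip is encoded as a Borel measure on R[i] whose
   value on the complement of the strip is 0. It need not be finite a priori;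
   the moment of index (0, 0) forces finiteness. *)
Definition strip_moment_solution (R : realType) (r : R)
    (a : nat -> nat -> R[i]) (sigma : {measure set (borelC R) -> \bar R})
    : Prop :=
  sigma (~` strip r) = 0%E /\
  forall m n : nat,
    cintegrable sigma (strip r) (monoC m n) /\
    cintegral sigma (strip r) (monoC m n) = a m n.

(* When a m n is the integral of z^m (conj z)^n, s a m n is the integral of
   (Re z)^m (Im z)^n. *)
Definition s_of (R : realType) (a : nat -> nat -> R[i]) (m n : nat) : R[i] :=
  (0 +i* 1) ^+ n / 2 ^+ (m + n) *
  \sum_(0 <= k < m.+1) \sum_(0 <= j < n.+1)
    (-1) ^+ j * 'C(m, k)%:R * 'C(n, j)%:R * a (k + j)%N (m - k + (n - j))%N.

Definition fin_supp (R : realType) (alpha : nat -> nat -> R[i]) : Prop :=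
  finite_set [set p : nat * nat | alpha p.1 p.2 != 0].

(* The sum over ((m, n), (k, l)) of alpha m n * conj (alpha k l) * t m n k l:
   the big operator over a set is the sum of the nonzero terms, of which there
   are finitely many as soon as fin_supp alpha holds. *)
Definition quad_form (R : realType) (t : nat -> nat -> nat -> nat -> R[i])
    (alpha : nat -> nat -> R[i]) : R[i] :=
  \sum_(p \in [set: (nat * nat) * (nat * nat)])
    alpha p.1.1 p.1.2 * conjc (alpha p.2.1 p.2.2) * t p.1.1 p.1.2 p.2.1 p.2.2.

(* Main.v *)
(** The coordinate change [z = x + i y] turns the statement into a moment problem
    for [s m n] (the moment of [x^m y^n]) on [R x [-r, r]], and [y = 2 r t - r]
    turns it into one on [R x [0, 1]].

    Let [L] be the functional on polynomials in [x, t]. The hypotheses say that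
    [L (q(x)^2 b(t)^2) >= 0] and [L (q(x)^2 t (1 - t) b(t)^2) >= 0], and only this
    product form is needed. By parity of the exponents, [L (q(x)^2 t^i (1 - t)^j)]
    is non-negative, hence so is [L (p(x) t^i (1 - t)^j)] for [p > 0] on [R],
    because such a [p] is a product of sums of two squares. Expanding in the
    Bernstein basis in [t] gives [L f >= 0] for every polynomial [f >= 0] on the
    strip.

    The theorem of M. Riesz (Hahn-Banach) extends [L] to a positive functional on
    all functions dominated by polynomials, indicator functions included. Binary
    digits of a compactified [x] and of [t] cut the strip into a tree of cells
    whose masses split additively; laying these cells out as nested subintervals
    of an interval of length [L 1] produces two random variables for Lebesgue
    measure whose joint law represents [L] on Lipschitz functions of the
    compactified coordinates. Undoing the compactification (no mass sits at
    infinity, as [L (x^2)] is finite) yields the moments, and the law of [x + i y]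
    is the measure. *)
From HB Require Import structures.
Require Import Defs.
From mathcomp Require Import all_boot all_order all_algebra.
From mathcomp Require Import complex.
From mathcomp Require Import all_classical all_reals all_analysis.
From mathcomp Require Import measurable_realfun.
From mathcomp Require Import ring lra.

Set Implicit Arguments.
Unset Strict Implicit.
Unset Printing Implicit Defensive.

Import Order.TTheory GRing.Theory Num.Theory.
Import numFieldNormedType.Exports.

Local Open Scope classical_set_scope.
Local Open Scope ring_scope.
Local Open Scope complex_scope.

(** * Univariate positivity *)

Section UnivariatePositivity.
Variable R : rcfType.
Implicit Types (p q b : {poly R}).

(** A complex root [c + i d] of [p] has [d != 0], since [p] has no real root. The remainder of [p]
    modulo the real quadratic with roots [c + i d] and [c - i d] is affine and vanishes at a
    non-real point, hence is zero. *)
Lemma pos_poly_quadratic_factor p :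
    (forall x, 0 < p.[x]) -> (1 < size p)%N ->
  exists2 q : {poly R}, (size q < size p)%N &
    exists c d : R, d != 0 /\ p = q * (('X - c%:P) ^+ 2 + (d ^+ 2)%:P).
Proof.
move=> p_gt0 sp.
pose h : {rmorphism R -> R[i]} := real_complex R.
have /closed_rootP[[c d] /rootP rz] : size (map_poly h p) != 1%N.
  by rewrite size_map_poly; case: (size p) sp => [|[]].
have d0 : d != 0.
  apply/eqP => d0; move: rz; rewrite d0 -[c +i* 0]/(h c) horner_map /=.
  by case=> pc0; have := p_gt0 c; rewrite pc0 ltxx.
pose Q : {poly R} := ('X - c%:P) ^+ 2 + (d ^+ 2)%:P.
have sQ : size Q = 3%N.
  by rewrite size_polyDl size_exp_XsubC// (leq_ltn_trans (size_polyC_leq1 _)).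
have Q0 : Q != 0 by rewrite -size_poly_eq0 sQ.
have hQ : (map_poly h Q).[c +i* d] = 0.
  rewrite /Q rmorphD rmorphXn rmorphB /= map_polyX !map_polyC /= !hornerE.
  by rewrite /real_complex_def; apply/eqP; rewrite eq_complex /=; apply/andP; split; apply/eqP; ring.
have pQ := divp_eq p Q.
have sr : (size (p %% Q)%R < 3)%N by rewrite -sQ ltn_modp.
have /eqP : (map_poly h (p %% Q)).[c +i* d] = 0.
  by move: rz; rewrite {1}pQ rmorphD rmorphM /= hornerD hornerM hQ mulr0 add0r.
have rE : p %% Q = (p %% Q)`_1 *: 'X + ((p %% Q)`_0)%:P.
  apply/polyP => i; rewrite coefD coefZ coefX coefC.
  case: i => [|[|i]] /=; rewrite ?mulr0 ?mulr1 ?addr0 ?add0r //.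
  by rewrite nth_default// -ltnS (leq_trans sr).
rewrite rE rmorphD /= linearZ /= map_polyX map_polyC /= !hornerE.
rewrite /real_complex_def eq_complex /= !mul0r subr0 !addr0.
move=> /andP[/eqP e1 /eqP e2].
have r1 : (p %% Q)`_1 = 0.
  by apply/eqP; have /eqP := e2; rewrite mulf_eq0 (negPf d0) orbF.
have r0 : (p %% Q)`_0 = 0 by move: e1; rewrite r1 mul0r add0r.
have r00 : p %% Q = 0 by rewrite rE r1 r0 scale0r add0r.
rewrite r00 addr0 in pQ.
exists (p %/ Q); last by exists c, d.
by rewrite size_divp// sQ /= ltn_subrL /=; apply: leq_trans sp.
Qed.

Lemma pos_poly_form (l : {poly R} -> R) :
    {morph l : p q / p + q} -> (forall p, 0 <= l (p ^+ 2)) ->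
  forall p, (forall x, 0 < p.[x]) -> 0 <= l p.
Proof.
(* The induction needs a spare square: the claim becomes [0 <= l (p * b ^+ 2)] for every [b], so
   that the two squares in a quadratic factor of [p] can be absorbed into [b]. *)
move=> lD l_ge0 p p_gt0; rewrite -[p]mulr1 -[1](expr1n _ 2).
elim/ltn_ind: {p}(size p) {-2}p (erefl (size p)) p_gt0 (1 : {poly R}) => n IH p sp p_gt0 b.
have [s1|s1] := leqP (size p) 1.
  have /size1_polyC pE := s1.
  have c_gt0 := p_gt0 0; rewrite pE hornerC in c_gt0.
  rewrite pE -(sqr_sqrtr (ltW c_gt0)) polyC_exp -exprMn; exact: l_ge0.
have [q sq [c [d [d0 pE]]]] := pos_poly_quadratic_factor p_gt0 s1.
have q_gt0 x : 0 < q.[x].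
  have := p_gt0 x; rewrite pE hornerM pmulr_lgt0// !hornerE.
  by rewrite ltr_wpDl ?sqr_ge0// exprn_even_gt0.
have -> : p * b ^+ 2 = q * (('X - c%:P) * b) ^+ 2 + q * (d%:P * b) ^+ 2.
  by rewrite pE !exprMn -polyC_exp mulrDr mulrDl !mulrA.
rewrite lD addr_ge0// (IH (size q)) -?sp//.
Qed.

End UnivariatePositivity.

(** * Moment functionals of polynomials *)

Section MomentFunctional.
Variable R : realType.
Implicit Types (m : nat -> R) (p q b : {poly R}).

Definition mom m p : R := \sum_(i < size p) p`_i * m i.

Lemma momE m p n : (size p <= n)%N -> mom m p = \sum_(i < n) p`_i * m i.
Proof.
move=> spn; rewrite /mom (big_ord_widen n (fun i => p`_i * m i) spn) big_mkcond.
by apply: eq_bigr => i _; case: ltnP => // spi; rewrite nth_default// mul0r.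
Qed.

Lemma mom_linear m : linear_for *%R (mom m).
Proof.
move=> a p q; set n := maxn (size p) (size q).
have sp : (size p <= n)%N by rewrite leq_maxl.
have sq : (size q <= n)%N by rewrite leq_maxr.
have spq : (size (a *: p + q)%R <= n)%N.
  rewrite (leq_trans (size_polyD _ _))// geq_max sq andbT.
  by rewrite (leq_trans (size_scale_leq _ _)).
rewrite (momE m sp) (momE m sq) (momE m spq) mulr_sumr -big_split /=.
by apply: eq_bigr => i _; rewrite coefD coefZ mulrDl mulrA.
Qed.

HB.instance Definition _ m :=
  GRing.isLinear.Build R {poly R} R *%R (mom m) (mom_linear m).

Lemma momXn m k : mom m 'X^k = m k.
Proof.
rewrite /mom size_polyXn (bigD1 ord_max)//= big1 => [|i /negPf ik].
  by rewrite coefXn eqxx mul1r addr0.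
by rewrite coefXn -[i == k :> nat]/(i == ord_max) ik mul0r.
Qed.

Lemma eq_mom m m' p : m =1 m' -> mom m p = mom m' p.
Proof. by move=> mm'; apply: eq_bigr => i _; rewrite mm'. Qed.

Lemma mom_linear_seq a m m' p :
  mom (fun i => a * m i + m' i) p = a * mom m p + mom m' p.
Proof.
rewrite /mom mulr_sumr -big_split /=; apply: eq_bigr => i _.
by rewrite mulrDr mulrCA.
Qed.

(** The functional with moments [m] at the product [q(x) b(t)]; iterating the univariate functional
    stands in for bivariate polynomials. *)
Definition bimom (m : nat -> nat -> R) q b : R := mom (fun i => mom (m i) b) q.

Lemma bimom_linear (m : nat -> nat -> R) q : linear_for *%R (bimom m q).
Proof.
move=> a b b'; rewrite /bimom -mom_linear_seq; apply: eq_mom => i.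
exact: mom_linear.
Qed.

HB.instance Definition _ (m : nat -> nat -> R) q :=
  GRing.isLinear.Build R {poly R} R *%R (bimom m q) (bimom_linear m q).

Lemma bimomXn (m : nat -> nat -> R) q k : bimom m q 'X^k = mom (m^~ k) q.
Proof. by apply: eq_mom => i; rewrite momXn. Qed.

Lemma bimomD (m : nat -> nat -> R) p q b :
  bimom m (p + q) b = bimom m p b + bimom m q b.
Proof. exact: raddfD. Qed.

Lemma bimomZ (m : nat -> nat -> R) a p b :
  bimom m (a *: p) b = a * bimom m p b.
Proof. exact: scalarZ. Qed.

Lemma bimom_sum (m : nat -> nat -> R) I (s : seq I) (F : I -> {poly R}) b :
  bimom m (\sum_(i <- s) F i) b = \sum_(i <- s) bimom m (F i) b.
Proof. exact: raddf_sum. Qed.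

End MomentFunctional.

(** * Bernstein expansions of monomials *)

Section Bernstein.
Variable R : realType.
Implicit Types (p q b : {poly R}).

(** The coordinates of [t ^ k] in the Bernstein basis of degree [N]; they approach [(i / N) ^ k]
    uniformly in [i]. *)
Definition bern_coef (N k i : nat) : R := (i ^_ k)%:R / (N ^_ k)%:R.

Definition bern_poly (N i : nat) : {poly R} :=
  'C(N, i)%:R *: ('X^i * (1 - 'X) ^+ (N - i)).

(** Multiplied by [(i - k)! (N - i)!], both sides become [N!]. *)
Lemma ffact_mul_bin (N k i : nat) : (k <= i <= N)%N ->
  (i ^_ k * 'C(N, i) = N ^_ k * 'C(N - k, i - k))%N.
Proof.
move=> /andP[ki iN]; have kN := leq_trans ki iN.
have E : (N - k - (i - k) = N - i)%N by rewrite subnBA// subnK.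
apply/eqP; rewrite -(@eqn_pmul2r ((i - k)`! * (N - i)`!)) ?muln_gt0 ?fact_gt0//.
rewrite mulnACA ffact_fact// mulnCA bin_fact//.
by rewrite -mulnA -E bin_fact ?leq_sub2r// ffact_fact.
Qed.

(** This is the binomial expansion of [t ^ k (t + (1 - t)) ^ (N - k)] with the index shifted by [k];
    the extra terms with [i < k] are zero because [i ^_ k] is. *)
Lemma bern_polyXn (N k : nat) : (k <= N)%N ->
  'X^k = \sum_(i < N.+1) bern_coef N k i *: bern_poly N i.
Proof.
move=> kN; rewrite -(big_mkord xpredT (fun i => bern_coef N k i *: bern_poly N i)).
rewrite (@big_cat_nat _ _ _ k)//=; last exact: leqW.
rewrite big_nat_cond big1 ?add0r; last first.
  by move=> i; rewrite andbT /= => ik; rewrite /bern_coef ffact_small// mul0r scale0r.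
rewrite -{2}[k]add0n big_addn big_mkord subSn//.
rewrite -[LHS]mulr1 -[1 in LHS](expr1n _ (N - k)) -{1}[1](subrK 'X) exprDn mulr_sumr.
apply: eq_bigr => -[j /=]; rewrite ltnS => jN _.
have jkN : (j + k <= N)%N by rewrite -(subnK kN) leq_add2r.
rewrite /bern_coef /bern_poly scalerA mulrAC -natrM.
rewrite ffact_mul_bin ?leq_addl// addnK natrM mulrAC mulfV ?mul1r; last first.
  by rewrite pnatr_eq0 -lt0n ffact_gt0.
rewrite scaler_nat mulrnAr subnDA (subnAC N) addnC exprD -mulrA.
by rewrite [(1 - 'X) ^+ _ * _]mulrC.
Qed.

(** The coefficient for [k.+1] is the one for [k] times [(i - k) / (N - k)], which is close to
    [i / N] for large [N]. As all these numbers lie in [[0, 1]], the errors of the two factors add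
    up. *)
Lemma bern_coef_cvg k (e : R) : 0 < e -> exists N0, forall N i,
  (N0 <= N)%N -> (i <= N)%N -> `|bern_coef N k i - (i%:R / N%:R) ^+ k| <= e.
Proof.
elim: k e => [|k IH] e e0.
  by exists 0%N => N i _ _; rewrite /bern_coef !ffactn0 divr1 subrr normr0 ltW.
have e20 : 0 < e / 2 by rewrite divr_gt0.
have [N1 hN1] := IH _ e20.
have [N2 hN2] : exists N2, forall N, (N2 <= N)%N -> (k < N)%N /\ k%:R <= e / 2 * (N - k)%:R.
  exists (k + (Num.bound (k%:R / (e / 2))).+1)%N => N kN.
  have kN' : (k < N)%N by rewrite (leq_trans _ kN)// -addn1 leq_add2l.
  split=> //; rewrite -ler_pdivrMl// mulrC ltW//.
  have /archi_boundP/lt_le_trans : 0 <= k%:R / (e / 2) by rewrite divr_ge0// ltW.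
  by apply; rewrite ler_nat leq_subRL ?(ltnW kN')// (leq_trans _ kN)// leq_add2l.
exists (maxn N1 N2) => N i; rewrite geq_max => /andP[/hN1 {}hN1 /hN2 [kN {}hN2]] iN.
have N0 : 0 < N%:R :> R by rewrite ltr0n (leq_ltn_trans _ kN).
have Nk0 : 0 < (N - k)%:R :> R by rewrite ltr0n subn_gt0.
set t := i%:R / N%:R in hN1 *.
have t01 : 0 <= t <= 1.
  by rewrite /t divr_ge0//= ler_pdivrMr// mul1r ler_nat.
have -> : bern_coef N k.+1 i = bern_coef N k i * ((i - k)%:R / (N - k)%:R).
  by rewrite /bern_coef !ffactnSr !natrM invfM mulrACA.
set c := bern_coef N k i in hN1 *.
have c01 : 0 <= c <= 1.
  rewrite /c /bern_coef divr_ge0//= ler_pdivrMr ?ltr0n ?ffact_gt0 1?ltnW// mul1r ler_nat.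
  by elim: (k) => [|j IHj]; rewrite ?ffactn0// !ffactnSr leq_mul// leq_sub2r.
have d_le : `|(i - k)%:R / (N - k)%:R - t| <= e / 2.
  (* For [i < k] the truncated difference [i - k] is zero, and [i / N] itself is small. *)
  have [ki|ki] := leqP k i; last first.
    have -> : (i - k = 0)%N by apply/eqP; rewrite subn_eq0 ltnW.
    rewrite mul0r sub0r normrN ger0_norm; last by case/andP: t01.
    rewrite /t ler_pdivrMr// (le_trans (_ : _ <= k%:R)) ?ler_nat 1?ltnW//.
    by rewrite (le_trans hN2)// ler_pM2l ?divr_gt0// ler_nat leq_subr.
  have -> : (i - k)%:R / (N - k)%:R - t = - (k%:R * (N - i)%:R / ((N - k)%:R * N%:R)).
    rewrite /t !natrB// 1?ltnW//; field.
    by rewrite -natrB 1?ltnW// !gt_eqF.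
  rewrite normrN ger0_norm ?divr_ge0 ?mulr_ge0//.
  rewrite ler_pdivrMr ?mulr_gt0// mulrA ler_pM//.
  by rewrite ler_nat leq_subr.
rewrite exprSr -[c * _](subrK (c * t)) -mulrBr -addrA -mulrBl.
rewrite (le_trans (ler_normD _ _))// [leRHS]splitr (normrM c) (normrM (c - _)) lerD//.
  by rewrite -[leRHS]mul1r ler_pM// ger0_norm; move: c01 => /andP[].
by rewrite -[leRHS]mulr1 ler_pM// ?hN1// ger0_norm; move: t01 => /andP[].
Qed.

End Bernstein.

(** * Positivity on the strip *)

Section PositivityOnTheStrip.
Variable R : realType.
Implicit Types (p q b : {poly R}) (s : seq ({poly R} * nat)).
Variable m : nat -> nat -> R.
Hypothesis m_sqr : forall q b, 0 <= bimom m (q ^+ 2) (b ^+ 2).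
Hypothesis m_itv : forall q b,
  0 <= bimom m (q ^+ 2) ('X * (1 - 'X) * b ^+ 2).

(** The even parts of the exponents form a square, leaving a factor [1], [t], [1 - t] or
    [t (1 - t)]. The middle two are covered by [t = t^2 + t (1 - t)] and
    [1 - t = (1 - t)^2 + t (1 - t)]. *)
Lemma bimom_bern_sqr q i j : 0 <= bimom m (q ^+ 2) ('X^i * (1 - 'X) ^+ j).
Proof.
rewrite -(odd_double_half i) -(odd_double_half j) !exprD -!mul2n !(mulnC 2%N) !exprM.
rewrite mulrACA -exprMn; set b := 'X^(i./2) * _ ^+ _.
case: (odd i); case: (odd j); rewrite /= ?expr1 ?expr0 ?mul1r ?mulr1 //.
- have -> : 'X * b ^+ 2 = ('X * b) ^+ 2 + 'X * (1 - 'X) * b ^+ 2 by ring.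
  by rewrite raddfD addr_ge0 ?m_sqr ?m_itv.
- have -> : (1 - 'X) * b ^+ 2 = ((1 - 'X) * b) ^+ 2 + 'X * (1 - 'X) * b ^+ 2 by ring.
  by rewrite raddfD addr_ge0 ?m_sqr ?m_itv.
Qed.

Lemma bimom_bern_pos p N i : (forall x, 0 < p.[x]) -> 0 <= bimom m p (bern_poly R N i).
Proof.
apply: (@pos_poly_form _ (fun p => bimom m p _)) => [q q'|q]; first exact: bimomD.
by rewrite scalarZ mulr_ge0// bimom_bern_sqr.
Qed.

(* The list [s] stands for the polynomial in [x] and [t] that is the sum of the
   [p.1(x) * t ^ p.2] over the entries [p] of [s]. *)
Definition eval_seq s (x t : R) : R := \sum_(p <- s) p.1.[x] * t ^+ p.2.

Definition mom_seq s : R := \sum_(p <- s) mom (m^~ p.2) p.1.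

Lemma bern_coef_cvg_seq s (e : R) : 0 < e -> exists N, (0 < N)%N /\
  forall pk, pk \in s -> (pk.2 <= N)%N /\ forall i, (i <= N)%N ->
    `|bern_coef R N pk.2 i - (i%:R / N%:R) ^+ pk.2| <= e.
Proof.
move=> e0; suff [N0 hN] : exists N0, forall N, (N0 <= N)%N -> forall pk, pk \in s ->
    (pk.2 <= N)%N /\ forall i, (i <= N)%N ->
    `|bern_coef R N pk.2 i - (i%:R / N%:R) ^+ pk.2| <= e.
  by exists N0.+1; split=> //; exact: hN.
elim: s => [|p s [N1 hN1]]; first by exists 0%N.
have [N2 hN2] := bern_coef_cvg p.2 e0.
exists (maxn (maxn N1 N2) p.2) => N; rewrite !geq_max -andbA => /and3P[N1N N2N pN] q.
rewrite inE => /orP[/eqP ->|qs]; last exact: hN1.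
by split=> // i; exact: hN2.
Qed.

(** In the Bernstein basis of degree [N] the coefficient of index [i] is a polynomial in [x] close
    to the value of [s] at [t = i / N], which is non-negative. Adding [e * Q] makes it positive, so
    that [bimom_bern_pos] applies; then [e] tends to [0]. *)
Lemma mom_seq_ge0 s : (forall x t, 0 <= t <= 1 -> 0 <= eval_seq s x t) ->
  0 <= mom_seq s.
Proof.
(* [Q] exceeds the sum of the [|p.1|], so [e * Q] outweighs errors of size [e] in the coefficients;
   the leading [1] makes the result strictly positive. *)
move=> s_ge0; pose Q : {poly R} := 1 + \sum_(p <- s) (1 + p.1 ^+ 2).
suff bound e : 0 < e -> 0 <= mom_seq s + e * bimom m Q 1.
  rewrite leNgt; apply/negP => s_lt0; set B := bimom m Q 1 in bound.
  have B0 : 0 <= B.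
    have := bound 1 ltr01; rewrite mul1r => /le_trans; apply.
    by rewrite gerDr ltW.
  have B1 : 0 < B + 1 by rewrite ltr_wpDl.
  (* An [e] that contradicts the bound: [e * (B + 1)] is half of [- mom_seq s]. *)
  pose e := - mom_seq s / (B + 1) / 2.
  have e0 : 0 < e by rewrite !divr_gt0 ?oppr_gt0.
  have eB : e * (B + 1) = - mom_seq s / 2 by rewrite /e; field; rewrite gt_eqF.
  by have := bound _ e0; lra.
move=> e0; have [N [N0 hN]] := bern_coef_cvg_seq s e0.
pose r i : {poly R} := \sum_(p <- s) bern_coef R N p.2 i *: p.1 + e *: Q.
have r_gt0 i x : (i <= N)%N -> 0 < (r i).[x].
  move=> iN; set t : R := i%:R / N%:R.
  have t01 : 0 <= t <= 1.
    by rewrite /t divr_ge0//= ler_pdivrMr ?ltr0n// mul1r ler_nat.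
  rewrite (le_lt_trans (s_ge0 x t t01))// /r !hornerE !horner_sum -subr_gt0.
  rewrite addrAC -sumrB mulrDr mulr1 addrCA ltr_pwDl// mulr_sumr -big_split /=.
  rewrite big_seq sumr_ge0// => p ps; have [_ /(_ i iN)] := hN p ps.
  rewrite -/t !hornerE.
  move: (p.1.[x]) (bern_coef _ _ _ _) (t ^+ _) => y c w /ler_normlP[cw1 cw2].
  have e1 : 0 <= e * (y - 1) ^+ 2 by rewrite mulr_ge0 ?(ltW e0)// sqr_ge0.
  have e2 : 0 <= e * (y + 1) ^+ 2 by rewrite mulr_ge0 ?(ltW e0)// sqr_ge0.
  have [y0|/ltW y0] := leP 0 y.
    have : 0 <= (c - w + e) * y by rewrite mulr_ge0//; lra.
    nra.
  have : 0 <= (e - (c - w)) * - y by rewrite mulr_ge0//; lra.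
  nra.
have -> : mom_seq s + e * bimom m Q 1 = \sum_(i < N.+1) bimom m (r i) (bern_poly R N i).
  have one : 1 = \sum_(i < N.+1) bern_poly R N i.
    rewrite -(expr0 'X) (bern_polyXn R (leq0n N)); apply: eq_bigr => i _.
    by rewrite /bern_coef !ffactn0 divr1 scale1r.
  under eq_bigr do rewrite bimomD bimomZ bimom_sum.
  rewrite big_split /= -mulr_sumr {1}one raddf_sum; congr (_ + _).
  rewrite exchange_big /=; apply: eq_big_seq => p ps.
  rewrite -bimomXn (bern_polyXn R (hN p ps).1) raddf_sum.
  by apply: eq_bigr => i _; rewrite bimomZ [LHS]scalarZ.
by apply: sumr_ge0 => i _; apply: bimom_bern_pos => x; rewrite r_gt0// -ltnS.
Qed.

End PositivityOnTheStrip.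

(** * Extension of positive functionals *)

Section HahnBanach.
Variables (R : realType) (V : lmodType R) (S : set V).
Hypothesis SD : forall f g, S f -> S g -> S (f + g).
Hypothesis SZ : forall a f, S f -> S (a *: f).

(** Homogeneity is an inequality here, which is what infima satisfy directly; [sublinear_scale]
    turns it into an equality. *)
Definition sublinear_on (p : V -> R) :=
  (forall f g, S f -> S g -> p (f + g) <= p f + p g) /\
  (forall a f, 0 <= a -> S f -> p (a *: f) <= a * p f).

Let SN f : S f -> S (- f). Proof. by rewrite -scaleN1r; exact: SZ. Qed.

Lemma le_mul_inf (E : set R) (a y : R) : 0 <= a -> E !=set0 ->
  (forall x, E x -> y <= a * x) -> y <= a * inf E.
Proof.
rewrite le_eqVlt => /predU1P[<-|a0] E0 yE.
  by have [x /yE] := E0; rewrite !mul0r.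
rewrite mulrC -ler_pdivrMr//; apply: lb_le_inf => // x /yE.
by rewrite mulrC -ler_pdivrMr.
Qed.

Lemma le_inf_add (E E' : set R) (y : R) : E !=set0 -> E' !=set0 ->
  (forall x x', E x -> E' x' -> y <= x + x') -> y <= inf E + inf E'.
Proof.
move=> E0 E'0 yE; rewrite -lerBlDr; apply: lb_le_inf => // x Ex.
rewrite lerBlDr addrC -lerBlDr; apply: lb_le_inf => // x' Ex'.
by rewrite lerBlDr addrC yE.
Qed.

Section Sublinear.
Variable p : V -> R.
Hypothesis p_sub : sublinear_on p.
Let pD := p_sub.1.
Let pZ := p_sub.2.

Lemma sublinear_scale a f : 0 <= a -> S f -> p (a *: f) = a * p f.
Proof.
move=> a0 Sf; apply/eqP; rewrite eq_le pZ//=.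
have [->|an0] := eqVneq a 0.
  rewrite mul0r scale0r; have S0 : S 0 by rewrite -(scale0r f); exact: SZ.
  by have := pD S0 S0; rewrite addr0 -lerBlDl subrr.
have a_gt0 : 0 < a by rewrite lt_neqAle eq_sym an0.
rewrite mulrC -ler_pdivlMr// mulrC -{1}[f](scale1r) -(mulVf an0) -scalerA.
by rewrite pZ ?invr_ge0//; exact: SZ.
Qed.

Lemma sublinear0 f : S f -> p 0 = 0.
Proof. by move=> Sf; rewrite -(scale0r f) sublinear_scale// mul0r. Qed.

Lemma sublinear_ge f g : S f -> S g -> p g - p (- f) <= p (f + g).
Proof.
move=> Sf Sg; rewrite lerBlDr addrC.
by have := pD (SN Sf) (SD Sf Sg); rewrite addKr.
Qed.

End Sublinear.

(** Zorn's lemma gives a minimal sublinear functional below [p0]. Minimality forces superadditivity,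
    hence additivity, and homogeneity for negative scalars follows. *)
Lemma hahn_banach_on (p0 : V -> R) : sublinear_on p0 ->
  exists L : V -> R,
    [/\ forall f g, S f -> S g -> L (f + g) = L f + L g,
        forall a f, S f -> L (a *: f) = a * L f
      & forall f, S f -> L f <= p0 f].
Proof.
move=> p0_sub.
pose T := {p : V -> R | sublinear_on p /\ forall f, S f -> p f <= p0 f}.
(* The order is reversed, so that a maximal element is a minimal functional; a non-empty chain is
   bounded by its pointwise infimum. *)
pose le_on (p q : T) := `[< forall f, S f -> sval q f <= sval p f >].
pose t0 : T := exist _ p0 (conj p0_sub (fun f _ => lexx (p0 f))).
have lower (p : T) f : S f -> - p0 (- f) <= sval p f.
  move=> Sf; have [psub ple] := svalP p.
  rewrite (@le_trans _ _ (- sval p (- f)))//; first by rewrite lerN2 ple//; exact: SN.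
  have S0 : S 0 by rewrite -(scale0r f); exact: SZ.
  by have := sublinear_ge psub Sf S0; rewrite addr0 (sublinear0 psub Sf) sub0r.
have [||A totA|[p [psub ple]] pmin] := @ZL_preorder T t0 le_on.
- by move=> p; apply/asboolP.
- move=> q p r /asboolP pq /asboolP qr; apply/asboolP => f Sf.
  exact: le_trans (qr f Sf) (pq f Sf).
- have [[p1 Ap1]|/set0P/negP/negbNE/eqP ->] := pselect (A !=set0); last by exists t0.
  pose E f := [set sval p f | p in A].
  have E0 f : E f !=set0 by exists (sval p1 f); exists p1.
  have Elb f : S f -> has_lbound (E f).
    by move=> Sf; exists (- p0 (- f)) => _ [p _ <-]; exact: lower.
  have leE f p : S f -> A p -> inf (E f) <= sval p f.
    by move=> Sf Ap; apply: ge_inf; [exact: Elb|exists p].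
  pose q f := inf (E f).
  have q_sub : sublinear_on q.
    split=> [f g Sf Sg|a f a0 Sf].
      apply: le_inf_add => // _ _ [p Ap <-] [p' Ap' <-].
      (* At [f + g] the smaller of the two comparable functionals is used. *)
      have [/asboolP pp'|/asboolP pp'] := totA _ _ Ap Ap'.
        apply: le_trans (leE _ _ (SD Sf Sg) Ap') _.
        by apply: le_trans ((svalP p').1.1 _ _ Sf Sg) _; rewrite lerD2r pp'.
      apply: le_trans (leE _ _ (SD Sf Sg) Ap) _.
      by apply: le_trans ((svalP p).1.1 _ _ Sf Sg) _; rewrite lerD2l pp'.
    apply: le_mul_inf => // _ [p Ap <-].
    apply: le_trans (leE _ _ (SZ a Sf) Ap) _; exact: (svalP p).1.2.
  have q_le f : S f -> q f <= p0 f.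
    by move=> Sf; apply: le_trans (leE _ _ Sf Ap1) _; exact: (svalP p1).2.
  exists (exist _ q (conj q_sub q_le)) => p Ap; apply/asboolP => f Sf /=.
  exact: leE.
(* A minimal sublinear functional is superadditive: perturb it along [h]. *)
have superadd f h : S f -> S h -> p f + p h <= p (f + h).
  move=> Sf Sh; pose E f := [set p (f + t *: h) - t * p h | t in [set t | 0 <= t]].
  have E0 g : E g !=set0 by exists (p (g + 0 *: h) - 0 * p h); exists 0 => /=.
  have leE g t : S g -> 0 <= t -> inf (E g) <= p (g + t *: h) - t * p h.
    move=> Sg t0'; apply: ge_inf; last by exists t.
    exists (- p (- g)) => _ [t' t'0 <-].
    have := sublinear_ge psub Sg (SZ t' Sh); rewrite (sublinear_scale psub)//; lra.
  pose q f := inf (E f).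
  have q_sub : sublinear_on q.
    split=> [g g' Sg Sg'|a g a0 Sg].
      apply: le_inf_add => // _ _ [t t0' <-] [t' t'0 <-].
      apply: le_trans (leE _ (t + t') (SD Sg Sg') (addr_ge0 t0' t'0)) _.
      rewrite scalerDl addrACA.
      have := psub.1 _ _ (SD Sg (SZ t Sh)) (SD Sg' (SZ t' Sh)); lra.
    apply: le_mul_inf => // _ [t t0' <-].
    apply: le_trans (leE _ (a * t) (SZ a Sg) (mulr_ge0 a0 t0')) _.
    rewrite -scalerA -scalerDr mulrBr mulrA lerD2r.
    by apply: psub.2 => //; exact: SD (SZ _ _).
  have q_le_p g : S g -> q g <= p g.
    by move=> Sg; have := leE g 0 Sg (lexx 0); rewrite scale0r addr0 mul0r subr0.
  have q_le f' : S f' -> q f' <= p0 f' by move=> Sf'; exact: le_trans (q_le_p _ Sf') (ple _ Sf').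
  pose tq : T := exist _ q (conj q_sub q_le).
  (* Minimality gives [p <= q]; the value [t = 1] in the infimum defining [q f] then yields the
     claim. *)
  have /asboolP /(_ f Sf) /= : le_on tq (exist _ p (conj psub ple)).
    by apply: pmin; apply/asboolP => g Sg /=; exact: q_le_p.
  move=> /le_trans /(_ (leE f 1 Sf ler01)).
  by rewrite scale1r mul1r -lerBrDr.
have pD f g : S f -> S g -> p (f + g) = p f + p g.
  by move=> Sf Sg; apply/eqP; rewrite eq_le superadd// psub.1.
exists p; split=> // a f Sf.
have [a0|a0] := leP 0 a; first by rewrite (sublinear_scale psub).
have := pD _ _ (SZ a Sf) (SZ (- a) Sf); rewrite -scalerDl subrr scale0r.
have Na0 : 0 <= - a by rewrite oppr_ge0 ltW.
by rewrite (sublinear0 psub Sf) (sublinear_scale psub Na0 Sf); lra.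
Qed.

End HahnBanach.

(** * The extension theorem of M. Riesz *)

Section PositiveExtension.
Variables (R : realType) (X : Type) (F : (X -> R) -> R -> Prop).
Hypothesis F0 : F 0 0.
Hypothesis FD : forall g l g' l', F g l -> F g' l' -> F (g + g') (l + l').
Hypothesis FZ : forall a g l, F g l -> F (a *: g) (a * l).
Hypothesis F_ge0 : forall g l, F g l -> (forall x, 0 <= g x) -> 0 <= l.
Hypothesis F_dom : forall g l, F g l ->
  exists g' l', F g' l' /\ forall x, `|g x| <= g' x.

Definition dominated (f : X -> R) := exists g l, F g l /\ forall x, `|f x| <= g x.

Lemma dominatedD f g : dominated f -> dominated g -> dominated (f + g).
Proof.
move=> [f' [l [Fl fl]]] [g' [l' [Fl' gl']]].
exists (f' + g'), (l + l'); split; first exact: FD.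
by move=> x; rewrite (le_trans (ler_normD _ _))// lerD.
Qed.

Lemma dominatedZ a f : dominated f -> dominated (a *: f).
Proof.
move=> [f' [l [Fl fl]]]; exists (`|a| *: f'), (`|a| * l).
by split=> [|x]; [exact: FZ|rewrite normrM ler_wpM2l].
Qed.

(** The sublinear majorant of [L] at [f] is the infimum of the values [l] of the functions [g] above
    [f]. For [f >= 0] it gives [L (- f) <= 0], which is positivity; applied to both [g] and [- g] it
    gives [L g = l]. *)
Lemma positive_extension : exists L : (X -> R) -> R,
  [/\ forall f g, dominated f -> dominated g -> L (f + g) = L f + L g,
      forall a f, dominated f -> L (a *: f) = a * L f,
      forall f, dominated f -> (forall x, 0 <= f x) -> 0 <= L f
    & forall g l, F g l -> L g = l].
Proof.
pose E f := [set l | exists g, F g l /\ forall x, f x <= g x].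
have E0 f : dominated f -> E f !=set0.
  move=> [g [l [Fl fl]]]; exists l, g; split=> // x.
  exact: le_trans (ler_norm _) (fl x).
have leE f l : dominated f -> E f l -> inf (E f) <= l.
  move=> [g [l' [Fl' fl']]] El; apply: ge_inf => //; exists (- l') => k [g' [Fk fk]].
  rewrite -subr_ge0 opprK; apply: (F_ge0 (FD Fk Fl')) => x /=.
  rewrite -lerBlDr sub0r (le_trans _ (fk x))// lerNl (le_trans _ (fl' x))//.
  by rewrite -normrN ler_norm.
have sub : sublinear_on dominated (fun f => inf (E f)).
  split=> [f g df dg|a f a0 df].
    apply: le_inf_add => [||l l' [f' [Fl fl]] [g' [Fl' gl']]]; [exact: E0..|].
    apply: leE; first exact: dominatedD.
    by exists (f' + g'); split=> [|x]; [exact: FD|exact: lerD].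
  apply: le_mul_inf => // [|l [f' [Fl fl]]]; first exact: E0.
  apply: leE; first exact: dominatedZ.
  by exists (a *: f'); split=> [|x]; [exact: FZ|exact: ler_wpM2l].
have [L [LD LZ Lle]] := hahn_banach_on dominatedD dominatedZ sub.
have LN f : dominated f -> L (- f) = - L f.
  by move=> df; rewrite -scaleN1r LZ// mulN1r.
have dN f : dominated f -> dominated (- f).
  by move=> df; rewrite -scaleN1r; exact: dominatedZ.
exists L; split=> // [f df f0|g l Fl].
  rewrite -oppr_le0 -LN// (le_trans (Lle _ (dN _ df)))// leE//; first exact: dN.
  by exists 0; split=> // x; rewrite /= oppr_le0.
have [g' [l' [Fl' gl']]] := F_dom Fl.
have dg : dominated g by exists g', l'.
apply/eqP; rewrite eq_le; apply/andP; split.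
  by rewrite (le_trans (Lle _ dg))// leE//; exists g.
rewrite -lerN2 -LN// (le_trans (Lle _ (dN _ dg)))// leE//; first exact: dN.
by exists (- g); split=> //; have := FZ (-1) Fl; rewrite scaleN1r mulN1r.
Qed.

End PositiveExtension.

(** * From a positive functional to random variables *)

(** Writes a function of words of length [n] as a combination of indicators of single words, so that
    it can be integrated, or fed to a positive functional, term by term. *)
Lemma sum_tuple_eq (R : pzRingType) (A : finType) n (g : seq A -> R) (p : seq A) :
  size p = n -> g p = \sum_(s : n.-tuple A) g s * (p == s)%:R.
Proof.
move=> /eqP sp; rewrite (bigD1 (Tuple sp))//= eqxx mulr1 big1 ?addr0// => s.
by rewrite -val_eqE /= eq_sym => /negPf ->; rewrite mulr0.
Qed.

Section PositiveForm.
Variables (R : realType) (X : Type) (S : set (X -> R)) (L : (X -> R) -> R).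
Hypothesis S_bounded : forall f (c : R), (forall x, `|f x| <= c) -> S f.
Hypothesis SD : forall f g, S f -> S g -> S (f + g).
Hypothesis SZ : forall a f, S f -> S (a *: f).
Hypothesis LD : forall f g, S f -> S g -> L (f + g) = L f + L g.
Hypothesis LZ : forall a f, S f -> L (a *: f) = a * L f.
Hypothesis L_ge0 : forall f, S f -> (forall x, 0 <= f x) -> 0 <= L f.

Lemma form_sum I (s : seq I) (a : I -> R) (F : I -> X -> R) :
  (forall i, S (F i)) ->
  S (fun x => \sum_(i <- s) a i * F i x) /\
  L (fun x => \sum_(i <- s) a i * F i x) = \sum_(i <- s) a i * L (F i).
Proof.
move=> SF; have E f : (fun x => \sum_(i <- s) f i x) = \sum_(i <- s) f i :> (X -> R).
  by apply/funext => x; rewrite fct_sumE.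
rewrite (E (fun i => a i *: F i)); elim: s {E} => [|i s [IS IL]].
  have S0 : S 0 by apply: (@S_bounded 0 0) => x; rewrite normr0.
  by rewrite !big_nil; split=> //; rewrite -(scale0r 0) LZ// mul0r.
have Si := SZ (a i) (SF i).
by rewrite !big_cons; split; [exact: SD|rewrite LD// LZ// IL].
Qed.

Lemma form_le f g : S f -> S g -> (forall x, f x <= g x) -> L f <= L g.
Proof.
move=> Sf Sg fg; have SNf : S (- f) by rewrite -scaleN1r; exact: SZ.
rewrite -subr_ge0 -mulN1r -LZ// scaleN1r -LD//.
by apply: L_ge0 => [|x]; [exact: SD|rewrite subr_ge0].
Qed.

Lemma form_dist f g h : S f -> S g -> S h -> (forall x, `|f x - g x| <= h x) ->
  `|L f - L g| <= L h.
Proof.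
move=> Sf Sg Sh fgh; have SNg : S (- g) by rewrite -scaleN1r; exact: SZ.
rewrite -mulN1r -LZ// scaleN1r -LD//; have Sfg := SD Sf SNg.
rewrite ler_norml; apply/andP; split; last first.
  by apply: form_le => // x; exact: le_trans (ler_norm _) (fgh x).
rewrite -mulN1r -LZ// scaleN1r; apply: form_le => //.
  by rewrite -scaleN1r; exact: SZ.
by move=> x; rewrite /= lerNl (le_trans _ (fgh x))// -normrN ler_norm.
Qed.

Definition total_mass : R := L (cst 1).

Lemma total_mass_ge0 : 0 <= total_mass.
Proof. by apply: L_ge0 => // ; apply: (@S_bounded _ 1) => x; rewrite normr1. Qed.

Let D : set (measurableTypeR R) := `[0, total_mass[%classic.
Let mu := @lebesgue_measure R.
Let mD : measurable D. Proof. exact: measurable_itv. Qed.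

Lemma lebesgue_D : mu D = total_mass%:E.
Proof.
rewrite /mu /D lebesgue_measure_itv /= lte_fin; case: ltP => [_|h]; first by rewrite sube0.
by congr (_%:E); apply/eqP; rewrite eq_le h total_mass_ge0.
Qed.

Lemma bounded_integrable_D (f : R -> R) c : measurable_fun setT f ->
  (forall t, D t -> `|f t| <= c) -> mu.-integrable D (EFin \o f).
Proof.
move=> mf fc; have D_fin : (mu D < +oo)%E by rewrite lebesgue_D ltry.
apply: (measurable_bounded_integrable _ D_fin) => //; first exact: measurable_funTS.
exists c; split; first exact: num_real.
by move=> x cx t Dt; exact: le_trans (fc t Dt) (ltW cx).
Qed.

(** * A tree of cells laid out as nested intervals *)

Section BinaryTree.
Variable b : nat -> X -> bool.

Definition cell_mass (s : seq bool) : R :=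
  L (fun x => (mkseq (b^~ x) (size s) == s)%:R).

(** The left endpoint of the interval assigned to [s]: the mass of the cells of the same depth that
    precede [s] lexicographically, grouped by the place where they leave [s]. *)
Definition cell_left (s : seq bool) : R :=
  \sum_(k < size s | nth false s k) cell_mass (rcons (take k s) false).

(** Binary search for the cell whose interval contains [t]: the threshold is the point where the
    left child ends and the right child begins. *)
Fixpoint branch (t : R) (n : nat) : seq bool :=
  if n is n'.+1 then
    let s := branch t n' in
    rcons s (cell_left s + cell_mass (rcons s false) <= t)
  else [::].

Let S_indic (P : X -> bool) : S (fun x => (P x)%:R).
Proof. by apply: (@S_bounded _ 1) => x; case: (P x); rewrite ?normr1 ?normr0. Qed.

Lemma cell_mass_ge0 s : 0 <= cell_mass s.
Proof. exact: L_ge0. Qed.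

Lemma cell_mass_nil : cell_mass [::] = total_mass.
Proof. by []. Qed.

Lemma cell_mass_rcons s :
  cell_mass s = cell_mass (rcons s false) + cell_mass (rcons s true).
Proof.
rewrite /cell_mass -LD//; congr L; apply/funext => x.
suff : (mkseq (b^~ x) (size s) == s)%:R =
    (mkseq (b^~ x) (size (rcons s false)) == rcons s false)%:R +
    (mkseq (b^~ x) (size (rcons s true)) == rcons s true)%:R :> R by [].
rewrite !size_rcons !mkseqS !eqseq_rcons.
by case: (_ == s); case: (b _ x); rewrite /= ?addr0 ?add0r.
Qed.

Lemma cell_left_rcons s c :
  cell_left (rcons s c) = cell_left s + (if c then cell_mass (rcons s false) else 0).
Proof.
rewrite /cell_left size_rcons big_mkcond big_ord_recr /= nth_rcons ltnn eqxx.
rewrite [in RHS]big_mkcond -cats1; congr (_ + _); last by rewrite take_size_cat.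
by apply: eq_bigr => i _; rewrite nth_cat ltn_ord takel_cat// ltnW.
Qed.

Lemma cell_left_bounds s :
  0 <= cell_left s /\ cell_left s + cell_mass s <= total_mass.
Proof.
elim/last_ind: s => [|s c [IH0 IH1]].
  by rewrite /cell_left big_ord0 add0r cell_mass_nil.
have := cell_mass_ge0 (rcons s false); have := cell_mass_ge0 (rcons s true).
by rewrite cell_left_rcons; move: IH1; rewrite cell_mass_rcons; case: c; split; lra.
Qed.

Lemma size_branch t n : size (branch t n) = n.
Proof. by elim: n => //= n IH; rewrite size_rcons IH. Qed.

(** By induction on the word: if the search has reached the parent of the cell, the threshold
    decides between the two children; otherwise [t] lies outside the interval of the parent, hence
    outside that of the child. A cell of mass zero has an empty interval and is never reached. *)
Lemma branch_eq t s : 0 <= t < total_mass ->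
  (branch t (size s) == s) = (cell_left s <= t < cell_left s + cell_mass s).
Proof.
move=> t01; elim/last_ind: s => [|s c IH].
  by rewrite /cell_left big_ord0 add0r cell_mass_nil t01.
have eqbE (x y : bool) : (x == y) = eqb x y by [].
rewrite size_rcons /= eqseq_rcons (eqbE _ c).
have [e|/negPf ne] := eqVneq (branch t (size s)) s.
  rewrite e; rewrite e eqxx cell_mass_rcons in IH; move/esym: IH => /andP[h1 h2].
  pose thr := cell_left s + cell_mass (rcons s false).
  rewrite cell_left_rcons -/thr; have [h3|h3] := boolP (thr <= t).
    case: c => /=; last by apply/esym/negbTE; rewrite addr0 -/thr negb_and -leNgt h3 orbT.
    by apply/esym/andP; rewrite /thr in h3 *; split; lra.
  case: c => /=; first by rewrite (negbTE h3).
  by rewrite -ltNge /thr in h3; apply/esym/andP; split; lra.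
move: IH; rewrite ne => /esym/negbT; rewrite negb_and -ltNge -leNgt => /orP h.
apply/esym/negbTE; rewrite /= negb_and -ltNge -leNgt cell_left_rcons; apply/orP.
have := cell_mass_ge0 (rcons s false); have := cell_mass_ge0 (rcons s true).
rewrite cell_mass_rcons in h.
by case: c; case: h => h m1 m0; [left|right|left|right]; lra.
Qed.

Lemma measurable_branch n s : measurable [set t | branch t n = s].
Proof.
elim: n s => [|n IH] s /=.
  by have [->|sn] := eqVneq s [::]; [rewrite (_ : mkset _ = setT)//; apply/seteqP
    |rewrite (_ : mkset _ = set0)//; apply/seteqP; split=> // t /= /esym/eqP; rewrite (negPf sn)].
case/lastP: s => [|s c].
  by rewrite (_ : mkset _ = set0)//; apply/seteqP; split=> // t /= /(congr1 size); rewrite size_rcons.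
pose a := cell_left s + cell_mass (rcons s false).
rewrite (_ : mkset _ = [set t | branch t n = s] `&`
    (if c then `[a, +oo[%classic else `]-oo, a[%classic)); last first.
  apply/seteqP; split=> t /=.
    move=> /eqP; rewrite eqseq_rcons => /andP[/eqP e /eqP <-]; split=> //.
    by rewrite e -/a; case: leP => h; rewrite /= in_itv /= ?andbT.
  move=> [e]; rewrite e -/a; case: c => /=; rewrite in_itv /= ?andbT; first by move->.
  by rewrite ltNge => /negbTE ->.
by apply: measurableI => //; case: c.
Qed.

Lemma measurable_branch_fun n (g : seq bool -> R) :
  measurable_fun setT (fun t => g (branch t n)).
Proof.
under eq_fun do rewrite (sum_tuple_eq g (size_branch _ n)).
apply: measurable_sum => s; apply: measurable_funM => //.
rewrite (_ : (fun _ => _) = \1_[set t | branch t n = s]).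
  by apply: measurable_indic; exact: measurable_branch.
apply/funext => t; rewrite indicE; congr (nat_of_bool _)%:R.
by apply/eqP/idP => [h|/set_mem //]; exact/mem_set.
Qed.

(** The first [n] bits of a point of [D] have the law prescribed by [L]: both sides are the sum of
    the [g s * cell_mass s], as the interval of [s] has length [cell_mass s]. *)
Lemma integral_branch n (g : seq bool -> R) :
  \int[mu]_(t in D) g (branch t n) = L (fun x => g (mkseq (b^~ x) n)).
Proof.
under [in RHS]eq_fun do rewrite (sum_tuple_eq g (size_mkseq _ n)).
rewrite (form_sum _ _ (fun s : n.-tuple bool => _)).2//.
pose I (s : seq bool) : set (measurableTypeR R) := `[cell_left s, cell_left s + cell_mass s[%classic.
have intI s : mu.-integrable D (EFin \o \1_(I s)).
  apply: (@bounded_integrable_D _ 1) => [|t _].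
    by apply: measurable_indic; exact: measurable_itv.
  by rewrite indicE; case: (_ \in _); rewrite ?normr1 ?normr0.
transitivity (\int[mu]_(t in D) \sum_(s : n.-tuple bool) g s * \1_(I s) t).
  apply: eq_Rintegral => t /set_mem; rewrite /D /= in_itv /= => Dt.
  rewrite (sum_tuple_eq g (size_branch t n)); apply: eq_bigr => s _; congr (_ * _%:R).
  by rewrite -{1}(size_tuple s) branch_eq// /I mem_setE in_itv.
rewrite /Rintegral; under eq_integral do rewrite -sumEFin.
rewrite (@integral_sum _ _ _ mu D _ _ (fun (s : n.-tuple bool) t => (g s * \1_(I s) t)%:E))//; last first.
  move=> s; apply: (eq_integrable mD _ _ _ (integrableZl mD (g s) (intI s))) => t _.
  by rewrite EFinM.
have E (s : n.-tuple bool) : (\int[mu]_(t in D) (g s * \1_(I s) t)%:E = (g s * cell_mass s)%:E)%E.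
  under eq_integral do rewrite EFinM.
  have mI : measurable (I s) by exact: measurable_itv.
  rewrite (integralZl mD (intI s)); transitivity ((g s)%:E * mu (I s `&` D))%E.
    by congr (_ * _)%E; exact: integral_indic.
  rewrite (_ : I s `&` D = I s); last first.
    apply/setIidPl => t; rewrite /I /D /= !in_itv /= => /andP[t1 t2].
    by have [h1 h2] := cell_left_bounds s; rewrite (le_trans h1 t1) (lt_le_trans t2 h2).
  rewrite /mu /I lebesgue_measure_itv /= lte_fin EFinM; congr (_ * _)%E; case: ifPn => [_|].
    by rewrite -EFinB addrAC subrr add0r.
  rewrite ltrDl -leNgt => h; congr EFin; apply/eqP.
  by rewrite eq_le h cell_mass_ge0.
under eq_bigr do rewrite E; rewrite sumEFin /=.
by apply: eq_bigr => s _; rewrite /cell_mass size_tuple.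
Qed.

End BinaryTree.

(** * Binary expansions in the unit interval *)

Section BinaryDigits.
Implicit Type beta : nat -> bool.

Definition digit_sum beta n : R := \sum_(k < n) (beta k)%:R * 2^-1 ^+ k.+1.

Definition digit_lim beta : R := limn (digit_sum beta).

Lemma digit_sumS beta n :
  digit_sum beta n.+1 = digit_sum beta n + (beta n)%:R * 2^-1 ^+ n.+1.
Proof. by rewrite /digit_sum big_ord_recr. Qed.

Lemma digit_sum_nd beta : nondecreasing_seq (digit_sum beta).
Proof.
by apply/nondecreasing_seqP => n; rewrite digit_sumS lerDl mulr_ge0// exprn_ge0.
Qed.

Lemma digit_sum_tail beta n m :
  digit_sum beta (n + m) + 2^-1 ^+ (n + m) <= digit_sum beta n + 2^-1 ^+ n.
Proof.
elim: m => [|m IH]; first by rewrite addn0.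
apply: le_trans IH; rewrite addnS digit_sumS -addrA lerD2l.
have : 0 <= 2^-1 ^+ (n + m) :> R by rewrite exprn_ge0.
by rewrite exprS; case: (beta _) => /=; lra.
Qed.

Lemma digit_sum_le beta n m :
  digit_sum beta m <= digit_sum beta n + 2^-1 ^+ n.
Proof.
have p k : 0 <= 2^-1 ^+ k :> R by rewrite exprn_ge0.
have [nm|mn] := leqP n m.
  rewrite -(subnKC nm); apply: le_trans (digit_sum_tail beta n (m - n)).
  by rewrite lerDl.
by apply: le_trans (digit_sum_nd beta (ltnW mn)) _; rewrite lerDl.
Qed.

Lemma is_cvg_digit_sum beta : cvgn (digit_sum beta).
Proof.
apply: nondecreasing_is_cvgn; first exact: digit_sum_nd.
by exists (digit_sum beta 0 + 2^-1 ^+ 0) => _ [m _ <-]; exact: digit_sum_le.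
Qed.

Lemma digit_lim_bounds beta n :
  digit_sum beta n <= digit_lim beta <= digit_sum beta n + 2^-1 ^+ n.
Proof.
have cv := @is_cvg_digit_sum beta; apply/andP; split.
  exact: nondecreasing_cvgn_le (@digit_sum_nd beta) cv n.
by apply: limr_le => //; apply: nearW => m; exact: digit_sum_le.
Qed.

Lemma digit_lim_itv beta : 0 <= digit_lim beta <= 1.
Proof. by have := digit_lim_bounds beta 0; rewrite /digit_sum big_ord0 add0r. Qed.

Lemma digit_sum_itv beta n : 0 <= digit_sum beta n <= 1.
Proof.
have := digit_sum_nd beta (leq0n n); have := digit_sum_le beta 0 n.
by rewrite /digit_sum big_ord0 add0r expr0 => -> ->.
Qed.

(** The greedy expansion. At [u = 1] every digit is [1], so that the closed unit interval is
    covered. *)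
Fixpoint binary_trunc (u : R) n : R :=
  if n is n'.+1 then
    let a := binary_trunc u n' in
    if a + 2^-1 ^+ n'.+1 <= u then a + 2^-1 ^+ n'.+1 else a
  else 0.

Definition binary_digit (u : R) n : bool :=
  binary_trunc u n + 2^-1 ^+ n.+1 <= u.

Lemma binary_truncE u n : digit_sum (binary_digit u) n = binary_trunc u n.
Proof.
elim: n => [|n IH]; first by rewrite /digit_sum big_ord0.
rewrite digit_sumS IH /= /binary_digit.
by case: ifP => _; rewrite ?mul1r ?mul0r ?addr0.
Qed.

Lemma binary_digit_bounds u n : 0 <= u <= 1 ->
  digit_sum (binary_digit u) n <= u <= digit_sum (binary_digit u) n + 2^-1 ^+ n.
Proof.
move=> u01; rewrite !binary_truncE; elim: n => [|n /andP[IH1 IH2]] /=; first by rewrite add0r.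
have E : 2^-1 ^+ n = 2^-1 ^+ n.+1 + 2^-1 ^+ n.+1 :> R by rewrite exprS; field.
have [h|/ltW h] := leP (binary_trunc u n + 2^-1 ^+ n.+1) u; rewrite h /= ?andbT//.
by rewrite -addrA -E.
Qed.

End BinaryDigits.

(** * A joint law on the unit square *)

Section TwoCoordinates.
Variables u v : X -> R.
Hypothesis u01 : forall x, 0 <= u x <= 1.
Hypothesis v01 : forall x, 0 <= v x <= 1.

(** The digits of [u] at even places and those of [v] at odd places, so that one path of the tree
    encodes a point of the square. *)
Let b k x := if odd k then binary_digit (v x) k./2 else binary_digit (u x) k./2.

Definition branch_bit t k : bool := nth false (branch b t k.+1) k.

Definition ucoord t : R := digit_lim (fun j => branch_bit t j.*2).
Definition vcoord t : R := digit_lim (fun j => branch_bit t j.*2.+1).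

(** Branches of increasing length extend one another, so that [t] determines a single infinite
    sequence of bits. *)
Lemma branch_mkseq t n : branch b t n = mkseq (branch_bit t) n.
Proof.
elim: n => [|n IH]; first by [].
rewrite mkseqS -IH /branch_bit /=; congr rcons.
by rewrite nth_rcons size_branch ltnn eqxx.
Qed.

Lemma ucoord_itv t : 0 <= ucoord t <= 1. Proof. exact: digit_lim_itv. Qed.
Lemma vcoord_itv t : 0 <= vcoord t <= 1. Proof. exact: digit_lim_itv. Qed.

Lemma measurable_digit_lim (h : nat -> nat) :
  measurable_fun setT (fun t : R => digit_lim (fun j => branch_bit t (h j))).
Proof.
apply: (measurable_fun_cvg (h := fun n t => digit_sum (fun j => branch_bit t (h j)) n)) => [n|t _].
  apply: measurable_sum => k; apply: measurable_funM => //.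
  exact: (measurable_branch_fun b (h k).+1 (fun s => (nth false s (h k))%:R)).
exact: is_cvg_digit_sum.
Qed.

Lemma measurable_ucoord : measurable_fun setT ucoord.
Proof. exact: measurable_digit_lim. Qed.

Lemma measurable_vcoord : measurable_fun setT vcoord.
Proof. exact: measurable_digit_lim. Qed.

Definition lipschitz_square (f : R -> R -> R) := exists C, forall x y x' y',
  0 <= x <= 1 -> 0 <= y <= 1 -> 0 <= x' <= 1 -> 0 <= y' <= 1 ->
  `|f x y - f x' y'| <= C * (`|x - x'| + `|y - y'|).

Lemma lipschitz_square_bounded f : lipschitz_square f ->
  exists c, forall x y, 0 <= x <= 1 -> 0 <= y <= 1 -> `|f x y| <= c.
Proof.
move=> [C fC]; exists (`|f 0 0| + `|C| * 2) => x y x01 y01.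
rewrite -[f x y](subrK (f 0 0)) (le_trans (ler_normD _ _))// addrC lerD2l.
have h01 : 0 <= (0 : R) <= 1 by rewrite lexx ler01.
rewrite (le_trans (fC _ _ _ _ x01 y01 h01 h01))// !subr0.
rewrite (le_trans (ler_norm _))// normrM ler_wpM2l// !ger0_norm ?addr_ge0//;
  move: x01 y01 => /andP[? ?] /andP[? ?] //; lra.
Qed.

(** Cutting both coordinates after [n] digits changes [f] by at most [2 |C| 2^-n]. What remains
    depends on the first [2 n] bits only, where the two sides agree by [integral_branch]; then [n]
    goes to infinity. *)
Lemma integral_coords (f : R -> R -> R) : lipschitz_square f ->
  measurable_fun setT (fun t => f (ucoord t) (vcoord t)) ->
  mu.-integrable D (fun t => (f (ucoord t) (vcoord t))%:E) /\
  \int[mu]_(t in D) f (ucoord t) (vcoord t) = L (fun x => f (u x) (v x)).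
Proof.
move=> flip mf; have [c fc] := lipschitz_square_bounded flip.
have [C fC] := flip.
have intf : mu.-integrable D (fun t => (f (ucoord t) (vcoord t))%:E).
  apply: (bounded_integrable_D (c := c) mf) => t _.
  by apply: fc; [exact: ucoord_itv|exact: vcoord_itv].
split=> //.
pose du beta n := digit_sum (fun j => beta j.*2 : bool) n.
pose dv beta n := digit_sum (fun j => beta j.*2.+1 : bool) n.
pose T := total_mass.
have C0 : 0 <= `|C| * T.
  by rewrite mulr_ge0// total_mass_ge0.
have key n : `|\int[mu]_(t in D) f (ucoord t) (vcoord t) - L (fun x => f (u x) (v x))|
    <= `|C| * T * 4 * 2^-1 ^+ n.
  pose g (s : seq bool) := f (du (nth false s) n) (dv (nth false s) n).
  have duE beta : du (nth false (mkseq beta n.*2)) n = du beta n.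
    by apply: eq_bigr => k _; rewrite nth_mkseq// ltn_double.
  have dvE beta : dv (nth false (mkseq beta n.*2)) n = dv beta n.
    by apply: eq_bigr => k _; rewrite nth_mkseq// ltn_Sdouble.
  have gt t : g (branch b t n.*2) = f (du (branch_bit t) n) (dv (branch_bit t) n).
    by rewrite /g branch_mkseq duE dvE.
  have gx x : g (mkseq (b^~ x) n.*2) =
      f (digit_sum (binary_digit (u x)) n) (digit_sum (binary_digit (v x)) n).
    rewrite /g duE dvE /du /dv /b; congr (f _ _); apply: eq_bigr => k _.
      by rewrite odd_double doubleK.
    by rewrite /= odd_double /= uphalf_double.
  have mg := measurable_branch_fun b n.*2 g.
  have intg : mu.-integrable D (fun t => (g (branch b t n.*2))%:E).
    apply: (bounded_integrable_D (c := c) mg) => t _.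
    by rewrite gt fc// digit_sum_itv.
  rewrite -(subrK (\int[mu]_(t in D) g (branch b t n.*2)) (\int[mu]_(t in D) f _ _)) -addrA.
  (* One half of the error comes from cutting under the integral, the other from cutting under
     [L]. *)
  have -> : `|C| * T * 4 * 2^-1 ^+ n = `|C| * (2 * 2^-1 ^+ n) * T + `|C| * (2 * 2^-1 ^+ n) * T by ring.
  have e0 : 0 <= `|C| * (2 * 2^-1 ^+ n) by rewrite !mulr_ge0// exprn_ge0// invr_ge0.
  have close x y x' y' : 0 <= x <= 1 -> 0 <= y <= 1 -> 0 <= x' <= 1 -> 0 <= y' <= 1 ->
      x' <= x <= x' + 2^-1 ^+ n -> y' <= y <= y' + 2^-1 ^+ n ->
      `|f x y - f x' y'| <= `|C| * (2 * 2^-1 ^+ n).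
    move=> hx hy hx' hy' /andP[x1 x2] /andP[y1 y2]; rewrite (le_trans (fC _ _ _ _ hx hy hx' hy'))//.
    rewrite (le_trans (ler_norm _))// normrM ler_wpM2l// ger0_norm ?addr_ge0//.
    rewrite !ger0_norm ?subr_ge0//; lra.
  rewrite (le_trans (ler_normD _ _))// lerD//.
    rewrite -RintegralB//.
    have intB : mu.-integrable D (EFin \o
        (fun t => f (ucoord t) (vcoord t) - g (branch b t n.*2))).
      by apply: (eq_integrable mD _ _ _ (integrableB mD intf intg)) => t _; rewrite /= EFinB.
    apply: le_trans (le_normr_Rintegral mD intB) _.
    have <- : \int[mu]_(t in D) (`|C| * (2 * 2^-1 ^+ n)) = `|C| * (2 * 2^-1 ^+ n) * T.
      rewrite (Rintegral_cst mu mD); congr (_ * _).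
      by rewrite -[RHS]/(fine total_mass%:E) -lebesgue_D.
    apply: le_Rintegral => //.
    - by apply: (eq_integrable mD _ _ _ (integrable_abse intB)) => t _.
    - by apply: (bounded_integrable_D (c := `|C| * (2 * 2^-1 ^+ n))) => // t _; rewrite ger0_norm.
    - move=> t _; rewrite gt; apply: close; rewrite ?ucoord_itv ?vcoord_itv ?digit_sum_itv//.
        exact: digit_lim_bounds.
      exact: digit_lim_bounds.
  rewrite integral_branch distrC.
  have Sf : S (fun x => f (u x) (v x)) by apply: (@S_bounded _ c) => x; exact: fc.
  have Sg : S (fun x => g (mkseq (b^~ x) n.*2)).
    by apply: (@S_bounded _ c) => x; rewrite gx fc ?digit_sum_itv.
  have Se (a : R) : S (cst a) by apply: (@S_bounded _ `|a|).
  have <- : L (cst (`|C| * (2 * 2^-1 ^+ n))) = `|C| * (2 * 2^-1 ^+ n) * T.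
    rewrite /T /total_mass -LZ//; congr L; apply/funext => x.
    by rewrite -[RHS]/(_ * 1) mulr1.
  apply: form_dist => // x; rewrite gx.
  by apply: close; rewrite ?digit_sum_itv// binary_digit_bounds.
apply/eqP; rewrite -subr_eq0 -normr_eq0 eq_le normr_ge0 andbT.
apply/ler_addgt0Pl => e e0; rewrite addr0.
have [n hn] : exists n, `|C| * T * 4 * 2^-1 ^+ n <= e.
  pose K := `|C| * T * 4; exists (Num.bound (K / e)); set n := Num.bound _.
  rewrite -/K exprVn ler_pdivrMr ?exprn_gt0// mulrC -ler_pdivrMr//.
  have /archi_boundP/ltW/le_trans : 0 <= K / e.
    by rewrite divr_ge0 ?(ltW e0)// mulr_ge0.
  by apply; rewrite -/n -natrX ler_nat ltnW// ltn_expl.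
exact: le_trans (key n) hn.
Qed.

End TwoCoordinates.
End PositiveForm.

(** * Removing the compactification *)

Lemma measurable_invr (R : realType) : measurable_fun setT (@GRing.inv R).
Proof.
have -> : setT = [set x : R | x != 0] `|` [set 0].
  by apply/seteqP; split=> // x _ /=; case: (eqVneq x 0) => [->|]; [right|left].
apply/measurable_funU; [exact: open_measurable|exact: measurable_set1|split].
  apply: open_continuous_measurable_fun => //; apply/in_setP => x /= x0.
  exact: inv_continuous.
exact: measurable_fun_set1.
Qed.

Section Decompactification.
Context d (T : measurableType d) (R : realType).
Variables (mu : {measure set T -> \bar R}) (D : set T) (P V : T -> R).
Variable m : nat -> nat -> R.
Hypothesis mD : measurable D.
Hypothesis mP : measurable_fun setT P.
Hypothesis mV : measurable_fun setT V.
Hypothesis P_le1 : forall t, `|P t| <= 1.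
Hypothesis V01 : forall t, 0 <= V t <= 1.

(** [P] is a compactified coordinate and [P / (1 - |P|)] the original one; [e > 0] keeps the
    denominator positive, also where [|P| = 1]. *)
Definition trunc_power n k (e : R) t := (P t / (1 - `|P t| + e)) ^+ n * V t ^+ k.

Hypothesis D_fin : (mu D < +oo)%E.
Hypothesis trunc_int : forall n k e, 0 < e ->
  mu.-integrable D (EFin \o trunc_power n k e).
Hypothesis trunc_le : forall e, 0 < e ->
  \int[mu]_(t in D) trunc_power 2 0 e t <= m 2 0.
Hypothesis trunc_cvg : forall n k,
  (\int[mu]_(t in D) trunc_power n k N.+1%:R^-1 t) @[N --> \oo] --> m n k.

Let C t := 1 - `|P t|.
Let C_ge0 t : 0 <= C t. Proof. by rewrite subr_ge0. Qed.

Definition finite_part : set T := [set t | 0 < C t].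
(* [0] where [C t = 0]; only its values on [finite_part] matter. *)
Definition xcoord t : R := P t / C t.

Lemma measurable_C : measurable_fun setT C.
Proof. by apply: measurable_funB => //; exact: measurableT_comp. Qed.

Lemma measurable_xcoord : measurable_fun setT xcoord.
Proof.
apply: measurable_funM => //; apply: measurableT_comp measurable_C.
exact: measurable_invr.
Qed.

Lemma measurable_finite_part : measurable finite_part.
Proof.
rewrite (_ : finite_part = setT `&` C @^-1` `]0, +oo[); last first.
  by rewrite setTI; apply/seteqP; split=> t; rewrite /= in_itv /= andbT.
by apply: measurable_C => //; exact: measurable_itv.
Qed.

(** Where [|P| = 1] the truncated square with parameter [1 / (N + 1)] is [(N + 1) ^ 2 >= N], so [N]
    times the mass of this set is at most [m 2 0] for every [N]. *)
Lemma infinite_part_null : mu (D `\` finite_part) = 0%E.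
Proof.
set A := D `\` _; have mA : measurable A by apply: measurableD => //; exact: measurable_finite_part.
have A_fin : (mu A < +oo)%E.
  by apply: le_lt_trans D_fin; apply: le_measure; rewrite ?inE//; exact: subDsetl.
have A_num : mu A \is a fin_num by rewrite ge0_fin_numE.
suff bound N : N%:R * fine (mu A) <= m 2 0.
  rewrite -(fineK A_num); congr EFin; apply/eqP.
  have A0 : 0 <= fine (mu A) by rewrite fine_ge0.
  rewrite eq_le A0 andbT leNgt; apply/negP => A_gt0.
  have m0 : 0 <= m 2 0 by have := bound 0%N; rewrite mul0r.
  have := archi_boundP (divr_ge0 m0 A0); rewrite ltr_pdivrMr// => /lt_le_trans.
  by move=> /(_ _ (bound _)); rewrite ltxx.
have e0 : 0 < N.+1%:R^-1 :> R by rewrite invr_gt0.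
apply: le_trans (trunc_le e0).
have mA' : measurable_fun D (\1_A : T -> R) by apply: measurable_indic.
have iA : mu.-integrable D (EFin \o (\1_A : T -> R)).
  apply: measurable_bounded_integrable => //; exists 1; split; first exact: num_real.
  move=> x x1 t Dt; apply: le_trans (ltW x1).
  by rewrite indicE; case: (t \in A); rewrite ?normr1 ?normr0.
have <- : \int[mu]_(t in D) (N%:R * \1_A t) = N%:R * fine (mu A).
  rewrite RintegralZl// /Rintegral integral_indic// setIidl//.
  by move=> t [].
apply: le_Rintegral => //.
- by apply: (eq_integrable mD _ _ _ (integrableZl mD N%:R iA)) => t _; rewrite /= EFinM.
- exact: trunc_int.
- move=> t Dt; rewrite /trunc_power expr0 mulr1 indicE.
  have [|_] := boolP (t \in A); last by rewrite mulr0 exprn_even_ge0.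
  move=> /set_mem [_ /negP]; rewrite /finite_part /= -leNgt => Ct.
  have Ct0 : C t = 0 by apply/eqP; rewrite eq_le Ct C_ge0.
  have P1 : `|P t| = 1 by move/eqP: Ct0; rewrite subr_eq0 => /eqP.
  rewrite -[1 - `|P t|]/(C t) Ct0 add0r invrK exprMn -real_normK ?num_real// P1 expr1n mul1r mulr1.
  by rewrite -natrX ler_nat (leq_trans (leqnSn N))// expnS expn1 leq_pmulr.
Qed.

Let F := D `&` finite_part.
Let mF : measurable F.
Proof. by apply: measurableI => //; exact: measurable_finite_part. Qed.

Lemma integral_finite_part (f : T -> R) : mu.-integrable D (EFin \o f) ->
  \int[mu]_(t in F) f t = \int[mu]_(t in D) f t.
Proof.
move=> fi; rewrite /Rintegral (negligible_integral _ mD fi infinite_part_null); last first.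
  by apply: measurableD => //; exact: measurable_finite_part.
by rewrite setDD.
Qed.

Lemma trunc_power_cvg n k t : finite_part t ->
  trunc_power n k N.+1%:R^-1 t @[N --> \oo] --> xcoord t ^+ n * V t ^+ k.
Proof.
move=> Ct; apply: cvgM; last exact: cvg_cst.
suff cv : P t / (1 - `|P t| + N.+1%:R^-1) @[N --> \oo] --> xcoord t.
  elim: n => [|n IH]; first by under eq_fun do rewrite expr0; exact: cvg_cst.
  by under eq_fun do rewrite exprS; rewrite exprS; exact: cvgM.
apply: cvgM; first exact: cvg_cst.
apply: cvgV; first by rewrite gt_eqF.
rewrite -[X in _ --> X]addr0; apply: cvgD; first exact: cvg_cst.
exact: cvg_harmonic.
Qed.

Lemma norm_trunc_power n k e t : finite_part t -> 0 < e ->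
  `|trunc_power n k e t| <= `|xcoord t| ^+ n.
Proof.
move=> Ct e0; rewrite /trunc_power normrM normrX -[leRHS]mulr1.
have Ce : 0 < C t + e by rewrite addr_gt0.
rewrite ler_pM//.
  rewrite lerXn2r ?nnegrE// /xcoord -/(C t) 2!normrM 2!normfV.
  by rewrite (gtr0_norm Ct) (gtr0_norm Ce) ler_wpM2l// lef_pV2 ?posrE// lerDl ltW.
have /andP[V0 V1] := V01 t.
by rewrite normrX ger0_norm// exprn_ile1.
Qed.

Lemma measurable_trunc_power n k e : measurable_fun setT (trunc_power n k e).
Proof.
apply: measurable_funM; apply: measurable_funX => //.
apply: measurable_funM => //; apply: measurableT_comp; first exact: measurable_invr.
by apply: measurable_funD => //; exact: measurable_C.
Qed.

Lemma integral_trunc_cvg n k :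
  (\int[mu]_(t in F) (trunc_power n k N.+1%:R^-1 t)%:E)%E @[N --> \oo] -->
  (m n k)%:E.
Proof.
have e0 N : 0 < N.+1%:R^-1 :> R by rewrite invr_gt0.
have E N : (\int[mu]_(t in F) (trunc_power n k N.+1%:R^-1 t)%:E)%E =
    (\int[mu]_(t in D) trunc_power n k N.+1%:R^-1 t)%:E.
  have iD := trunc_int n k (e0 N).
  rewrite -(integral_finite_part iD) /Rintegral fineK//; apply: integrable_fin_num => //.
  by apply: integrableS iD => //; exact: subIsetl.
by under eq_fun do rewrite E; apply: cvg_EFin; [exact: nearW|exact: trunc_cvg].
Qed.

(** Fatou's lemma: the truncated even powers are non-negative and their integrals converge to a
    moment. *)
Lemma even_power_integrable n : mu.-integrable F (fun t => (xcoord t ^+ n.*2)%:E).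
Proof.
have mX : measurable_fun F (fun t => (xcoord t ^+ n.*2)%:E).
  apply/measurable_EFinP/measurable_funTS/measurable_funX; exact: measurable_xcoord.
have even_ge0 (x : R) : 0 <= x ^+ n.*2 by rewrite exprn_even_ge0// odd_double.
apply/integrableP; split=> //.
have -> : (\int[mu]_(t in F) `|(xcoord t ^+ n.*2)%:E| =
    \int[mu]_(t in F) limn_einf (fun N => (trunc_power n.*2 0 N.+1%:R^-1 t)%:E))%E.
  apply: eq_integral => t /set_mem [_ Ct].
  have cv : (trunc_power n.*2 0 N.+1%:R^-1 t)%:E @[N --> \oo] --> (xcoord t ^+ n.*2)%:E.
    apply: cvg_EFin; first exact: nearW.
    by have := trunc_power_cvg (n := n.*2) (k := 0) Ct; rewrite expr0 mulr1.
  by rewrite (cvg_limn_einf_sup cv).1 gee0_abs// lee_fin.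
apply: le_lt_trans (fatou mu mF _ _) _.
- by move=> N; apply/measurable_EFinP/measurable_funTS; exact: measurable_trunc_power.
- by move=> N t _; rewrite lee_fin /trunc_power expr0 mulr1.
by rewrite (cvg_limn_einf_sup (@integral_trunc_cvg n.*2 0)).1 ltry.
Qed.

(** Dominated convergence: [|xcoord| ^ n] is at most [1 + xcoord ^ (2 n)], which is integrable by
    [even_power_integrable]. *)
Lemma moment_finite_part n k :
  mu.-integrable F (fun t => (xcoord t ^+ n * V t ^+ k)%:E) /\
  \int[mu]_(t in F) (xcoord t ^+ n * V t ^+ k) = m n k.
Proof.
have iF1 : mu.-integrable F (fun=> 1%:E).
  have F_fin : (mu F < +oo)%E.
    by apply: le_lt_trans D_fin; apply: le_measure; rewrite ?inE//; exact: subIsetl.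
  apply: (measurable_bounded_integrable (f := cst 1)) => //.
  exists 1; split; first exact: num_real.
  by move=> x x1 t _ /=; rewrite normr1; exact: ltW.
have idom := integrableD mF iF1 (even_power_integrable n).
have mXV : measurable_fun F (fun t => (xcoord t ^+ n * V t ^+ k)%:E).
  apply/measurable_EFinP/measurable_funTS/measurable_funM; apply: measurable_funX => //.
  exact: measurable_xcoord.
have [|||iXV _ cv] := dominated_convergence mF
    (f_ := fun N t => (trunc_power n k N.+1%:R^-1 t)%:E) _ mXV _ idom.
- by move=> N; apply/measurable_EFinP/measurable_funTS; exact: measurable_trunc_power.
- apply: aeW => t [_ Ct]; apply: cvg_EFin; first exact: nearW.
  exact: trunc_power_cvg.
- apply: aeW => t N [_ Ct]; rewrite /= lee_fin.
  have e0 : 0 < N.+1%:R^-1 :> R by rewrite invr_gt0.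
  apply: le_trans (norm_trunc_power n k Ct e0) _.
  rewrite -muln2 exprM -real_normK ?num_real// -[leLHS]normrX.
  by have := sqr_ge0 (`|xcoord t ^+ n| - 1); nra.
split=> //; rewrite /Rintegral.
by have := cvg_unique _ cv (integral_trunc_cvg (n := n) (k := k)) => ->.
Qed.

End Decompactification.

(** * The moment problem on the line times the unit interval *)

Section LipschitzSquare.
Variable R : realType.
Implicit Types f g : R -> R -> R.

Lemma lipschitz_squareM f g : lipschitz_square f -> lipschitz_square g ->
  lipschitz_square (fun x y => f x y * g x y).
Proof.
move=> flip glip; have [a fa] := lipschitz_square_bounded flip.
have [b gb] := lipschitz_square_bounded glip.
move: flip glip => [A fA] [B gB]; exists (a * B + b * A) => x y x' y' hx hy hx' hy'.
have -> : f x y * g x y - f x' y' * g x' y' =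
    f x y * (g x y - g x' y') + g x' y' * (f x y - f x' y') by ring.
rewrite (le_trans (ler_normD _ _))// !normrM mulrDl -!mulrA.
by rewrite lerD// ler_pM// ?fa ?gb ?fA ?gB.
Qed.

Lemma lipschitz_squareX f n : lipschitz_square f ->
  lipschitz_square (fun x y => f x y ^+ n).
Proof.
move=> flip; elim: n => [|n IH].
  by exists 0 => x y x' y' *; rewrite !expr0 subrr normr0 mul0r.
have -> : (fun x y => f x y ^+ n.+1) = (fun x y => f x y * f x y ^+ n).
  by apply/funext => x; apply/funext => y; rewrite exprS.
exact: lipschitz_squareM.
Qed.

(** The denominators are at least [e] and differ by at most [|p - p'|], while [|p'| <= 1]; hence the
    constant [e^-1 + e^-2], times the factor [2] of [2 x - 1]. *)
Lemma lipschitz_square_trunc (e : R) : 0 < e ->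
  lipschitz_square (fun x _ => (2 * x - 1) / (1 - `|2 * x - 1| + e)).
Proof.
move=> e0; exists ((e^-1 + e^-1 * e^-1) * 2) => x y x' y' x01 _ x'01 _.
have norm_le1 (z : R) : 0 <= z <= 1 -> `|2 * z - 1| <= 1.
  by move=> /andP[z0 z1]; rewrite ler_norml; apply/andP; split; lra.
have := norm_le1 x x01; have := norm_le1 x' x'01.
have pp : (2 * x - 1) - (2 * x' - 1) = 2 * (x - x') by ring.
set p := 2 * x - 1 in pp *; set p' := 2 * x' - 1 in pp * => p'1 p1.
set c := 1 - `|p| + e; set c' := 1 - `|p'| + e.
have ec : e <= c by rewrite lerDr subr_ge0.
have ec' : e <= c' by rewrite lerDr subr_ge0.
have c0 := lt_le_trans e0 ec; have c'0 := lt_le_trans e0 ec'.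
have d_ge : `|p - p'| = 2 * `|x - x'| by rewrite pp normrM ger0_norm.
have cc : `|c' - c| <= `|p - p'|.
  have -> : c' - c = `|p| - `|p'| by rewrite /c /c'; ring.
  exact: ler_dist_dist.
have -> : p / c - p' / c' = (p - p') * c^-1 + p' * (c' - c) * (c^-1 * c'^-1).
  by field; rewrite !gt_eqF.
rewrite (le_trans (ler_normD _ _))// !normrM.
rewrite (gtr0_norm (_ : 0 < c^-1)) ?invr_gt0// (gtr0_norm (_ : 0 < c'^-1)) ?invr_gt0//.
have ei0 : 0 <= e^-1 by rewrite invr_ge0 ltW.
have ci0 : 0 <= c^-1 by rewrite invr_ge0 ltW.
have ci'0 : 0 <= c'^-1 by rewrite invr_ge0 ltW.
have ci : c^-1 <= e^-1 by rewrite lef_pV2 ?posrE.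
have ci' : c'^-1 <= e^-1 by rewrite lef_pV2 ?posrE.
rewrite (@le_trans _ _ (`|p - p'| * e^-1 + `|p - p'| * (e^-1 * e^-1)))//.
  rewrite lerD ?ler_wpM2l//; apply: ler_pM; rewrite ?mulr_ge0//.
    by rewrite -[leRHS]mul1r ler_pM.
  exact: ler_pM.
have d_le : `|p - p'| <= 2 * (`|x - x'| + `|y - y'|) by rewrite d_ge ler_wpM2l// lerDl.
by rewrite -mulrDr mulrC -[leRHS]mulrA ler_wpM2l// addr_ge0// mulr_ge0.
Qed.

End LipschitzSquare.

(** * Representation of the moments by two random variables *)

Section MomentProblem.
Variables (R : realType) (m : nat -> nat -> R).
Hypothesis m_sqr : forall q b : {poly R}, 0 <= bimom m (q ^+ 2) (b ^+ 2).
Hypothesis m_itv : forall q b : {poly R},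
  0 <= bimom m (q ^+ 2) ('X * (1 - 'X) * b ^+ 2).

(** The strip is made a type, so that non-negativity on it is non-negativity everywhere, as the
    extension theorem asks. *)
Let X := {p : R * R | 0 <= p.2 <= 1}.
Implicit Type z : X.

(* A relation rather than a function: several lists represent the same function
   on the strip, and uniqueness of the value only follows from positivity. *)
Definition poly_value (g : X -> R) (l : R) := exists s : seq ({poly R} * nat),
  g = (fun z => eval_seq s (sval z).1 (sval z).2) /\ l = mom_seq m s.

Lemma poly_value0 : poly_value 0 0.
Proof.
exists [::]; split; last by rewrite /mom_seq big_nil.
by apply/funext => z; rewrite /eval_seq big_nil.
Qed.

Lemma poly_valueD g l g' l' :
  poly_value g l -> poly_value g' l' -> poly_value (g + g') (l + l').
Proof.
move=> [s [-> ->]] [s' [-> ->]]; exists (s ++ s'); split; last by rewrite /mom_seq big_cat.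
by apply/funext => z; rewrite /eval_seq big_cat.
Qed.

Lemma poly_valueZ a g l : poly_value g l -> poly_value (a *: g) (a * l).
Proof.
move=> [s [-> ->]]; exists [seq (a *: p.1, p.2) | p <- s].
split; last by rewrite /mom_seq big_map mulr_sumr; apply: eq_bigr => p _; rewrite scalarZ.
apply/funext => z; rewrite /eval_seq big_map; apply: etrans (mulr_sumr _ _ _ _) _.
by apply: eq_bigr => p _; rewrite hornerZ mulrA.
Qed.

Lemma poly_value_ge0 g l : poly_value g l -> (forall z, 0 <= g z) -> 0 <= l.
Proof.
move=> [s [-> ->]] s_ge0; apply: mom_seq_ge0 => // x t t01.
exact: (s_ge0 (exist _ (x, t) t01)).
Qed.

Lemma le_norm_sqr (x : R) : `|x| <= 1 + x ^+ 2.
Proof. by rewrite -real_normK ?num_real//; have := sqr_ge0 (`|x| - 1); nra. Qed.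

Lemma poly_value_dom g l : poly_value g l ->
  exists g' l', poly_value g' l' /\ forall z, `|g z| <= g' z.
Proof.
move=> [s [-> _]]; pose s' := [seq (1 + p.1 ^+ 2, 0%N) | p <- s].
exists (fun z => eval_seq s' (sval z).1 (sval z).2), (mom_seq m s').
split; first by exists s'.
move=> [[x t] /= /andP[t0 t1]]; rewrite /eval_seq big_map.
apply: le_trans (ler_norm_sum _ _ _) _; apply: ler_sum => p _ /=.
rewrite expr0 mulr1 normrM !hornerE -[leRHS]mulr1 ler_pM//.
  by have := le_norm_sqr p.1.[x]; rewrite expr2.
by rewrite normrX ger0_norm// exprn_ile1.
Qed.

Lemma poly_value_monomial n k :
  poly_value (fun z => (sval z).1 ^+ n * (sval z).2 ^+ k) (m n k).
Proof.
exists [:: ('X^n, k)]; split; last by rewrite /mom_seq big_seq1 momXn.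
by apply/funext => z; rewrite /eval_seq big_seq1 hornerXn.
Qed.

Lemma norm_div_ge1 (x q : R) : 1 <= q -> `|x / q| <= `|x|.
Proof.
move=> q1; have q0 : 0 < q by apply: lt_le_trans q1.
by rewrite normrM normfV (gtr0_norm q0) ler_pdivrMr// ler_peMr.
Qed.

Let S := dominated poly_value.

Lemma dominated_bounded (f : X -> R) (c : R) : (forall z, `|f z| <= c) -> S f.
Proof.
move=> fc; exists (c *: (fun z => (sval z).1 ^+ 0 * (sval z).2 ^+ 0)), (c * m 0 0).
split; first exact: poly_valueZ (poly_value_monomial 0 0).
by move=> z; rewrite (le_trans (fc z))// -[leRHS]/(c * (_ * _)) !expr0 !mulr1.
Qed.

Lemma dominated_le (f g : X -> R) : S g -> (forall z, `|f z| <= `|g z|) -> S f.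
Proof. by move=> [h [l [hl gh]]] fg; exists h, l; split=> // z; exact: le_trans (fg z) (gh z). Qed.

Lemma dominated_monomial n k : S (fun z => (sval z).1 ^+ n * (sval z).2 ^+ k).
Proof. by have [g [l [gl h]]] := poly_value_dom (poly_value_monomial n k); exists g, l. Qed.

(* The compactified coordinate [u = 1/2 + x / (2 (1 + |x|))] satisfies
   [2 u - 1 = x / (1 + |x|)] and [1 - |2 u - 1| = 1 / (1 + |x|)], so that
   [x] is the quotient of these two functions of [u]. *)
Definition compact_coord z : R :=
  2^-1 * (1 + (sval z).1 / (1 + `|(sval z).1|)).

Lemma compact_coord_trunc z (e : R) : 0 < e ->
  (2 * compact_coord z - 1) / (1 - `|2 * compact_coord z - 1| + e) =
  (sval z).1 / (1 + e * (1 + `|(sval z).1|)).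
Proof.
move=> e0; set x := (sval z).1; have x0 : 0 < 1 + `|x| by rewrite ltr_pwDl.
have -> : 2 * compact_coord z - 1 = x / (1 + `|x|).
  by rewrite /compact_coord -/x mulrA divff// mul1r addrAC subrr add0r.
rewrite normrM normfV (gtr0_norm x0); field.
have h : 0 < e * (1 + `|x|) by rewrite mulr_gt0.
by rewrite !gt_eqF//; lra.
Qed.

Lemma compact_coord_itv z : 0 <= compact_coord z <= 1.
Proof.
rewrite /compact_coord; set x := (sval z).1; have x0 : 0 < 1 + `|x| by rewrite ltr_pwDl.
have : `|x / (1 + `|x|)| <= 1.
  by rewrite normrM normfV (gtr0_norm x0) ler_pdivrMr// mul1r lerDr.
by rewrite ler_norml => /andP[h1 h2]; apply/andP; split; lra.
Qed.

(** With [q = 1 + e (1 + |x|)] the left side is [|x| ^ n (1 - q ^ -n)], and Bernoulli's inequality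
    gives [1 - q ^ -n <= n (1 - 1 / q) <= n (q - 1)]. *)
Lemma trunc_power_dist n (x e : R) : 0 <= e ->
  `|x ^+ n - (x / (1 + e * (1 + `|x|))) ^+ n| <= e * (n%:R * (`|x| ^+ n + `|x| ^+ n.+1)).
Proof.
move=> e0; set q := 1 + _; have eq0 : 0 <= e * (1 + `|x|) by rewrite mulr_ge0 ?addr_ge0.
have q1 : 1 <= q by rewrite lerDl.
have q0 : 0 < q by apply: lt_le_trans q1.
have t0 : 0 <= q^-1 by rewrite invr_ge0 ltW.
have t1 : q^-1 <= 1 by rewrite invf_le1.
rewrite expr_div_n -{1}[x ^+ n]mulr1 -mulrBr normrM normrX.
have -> : e * (n%:R * (`|x| ^+ n + `|x| ^+ n.+1)) = `|x| ^+ n * (n%:R * (e * (1 + `|x|))).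
  by rewrite exprS; ring.
rewrite ler_wpM2l ?exprn_ge0// -exprVn ger0_norm ?subr_ge0 ?exprn_ile1//.
have qe : 1 - q^-1 <= e * (1 + `|x|).
  have -> : e * (1 + `|x|) = q - 1 by rewrite /q addrAC subrr add0r.
  rewrite -(ler_pM2r q0) mulrBl mulVf ?gt_eqF//; nra.
apply: le_trans (_ : n%:R * (1 - q^-1) <= _); last by rewrite ler_wpM2l.
elim: n => [|n IH]; first by rewrite expr0 subrr mul0r.
rewrite exprS -natr1 mulrDl mul1r.
have := exprn_ge0 n t0; have := exprn_ile1 n t0 t1; nra.
Qed.

Theorem moment_problem_itv01 :
  exists (D : set (measurableTypeR R)) (Xc Vc : R -> R),
  [/\ measurable D, measurable_fun setT Xc, measurable_fun setT Vc,
      forall t, 0 <= Vc t <= 1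
    & forall n k,
      (@lebesgue_measure R).-integrable D (fun t => (Xc t ^+ n * Vc t ^+ k)%:E) /\
      \int[@lebesgue_measure R]_(t in D) (Xc t ^+ n * Vc t ^+ k) = m n k].
Proof.
have [L [LD LZ L_ge0 LF]] := positive_extension poly_value0 poly_valueD poly_valueZ
  poly_value_ge0 poly_value_dom.
have SD := dominatedD poly_valueD; have SZ := dominatedZ poly_valueZ.
pose v z := (sval z).2; have v01 z : 0 <= v z <= 1 := svalP z.
pose U := ucoord L compact_coord v; pose V := vcoord L compact_coord v.
pose D : set (measurableTypeR R) := `[0, total_mass L[%classic.
pose mu := @lebesgue_measure R.
have mU : measurable_fun setT U by exact: measurable_ucoord.
have mV : measurable_fun setT V by exact: measurable_vcoord.
(* [P] corresponds to [x / (1 + |x|)]. Then [trunc_power] corresponds to the functions [f] below,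
   which tend to the monomials as [e] tends to [0]. *)
pose P t := 2 * U t - 1.
have mP : measurable_fun setT P by apply: measurable_funB => //; apply: measurable_funM.
have P_le1 t : `|P t| <= 1.
  have /andP[U0 U1] := ucoord_itv L compact_coord v t.
  by rewrite ler_norml /P /U; apply/andP; split; lra.
have V01 t : 0 <= V t <= 1 := vcoord_itv L compact_coord v t.
have mD : measurable D by exact: measurable_itv.
have D_fin : (mu D < +oo)%E.
  by rewrite /mu /D (lebesgue_D dominated_bounded L_ge0) ltry.
pose f n k (e : R) z := ((sval z).1 / (1 + e * (1 + `|(sval z).1|))) ^+ n * (sval z).2 ^+ k.
have trunc_integral n k e : 0 < e -> mu.-integrable D (EFin \o trunc_power P V n k e) /\
    \int[mu]_(t in D) trunc_power P V n k e t = L (f n k e).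
  move=> e0; have := integral_coords dominated_bounded SD SZ LD LZ L_ge0
    compact_coord_itv v01 (f := fun u v => ((2 * u - 1) / (1 - `|2 * u - 1| + e)) ^+ n * v ^+ k).
  have -> : L (f n k e) = L (fun z => ((2 * compact_coord z - 1) /
      (1 - `|2 * compact_coord z - 1| + e)) ^+ n * v z ^+ k).
    by congr L; apply/funext => z; rewrite compact_coord_trunc.
  apply; last exact: measurable_trunc_power.
  apply: lipschitz_squareM; apply: lipschitz_squareX; first exact: lipschitz_square_trunc.
  by exists 1 => x y x' y' _ _ _ _; rewrite mul1r lerDr.
have Sf n k e : 0 < e -> S (f n k e).
  move=> e0; apply: dominated_le (dominated_monomial n k) _ => z.
  rewrite /f !normrM ler_wpM2r// !normrX lerXn2r ?nnegrE// norm_div_ge1// lerDl.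
  by rewrite mulr_ge0 ?addr_ge0// ltW.
have trunc_le e : 0 < e -> \int[mu]_(t in D) trunc_power P V 2 0 e t <= m 2 0.
  move=> e0; rewrite (trunc_integral 2 0 e e0).2 -(LF _ _ (poly_value_monomial 2 0)).
  apply: (form_le SD SZ LD LZ L_ge0 (Sf _ _ _ e0) (dominated_monomial 2 0)) => z.
  rewrite /f !expr0 !mulr1 -[leLHS]real_normK ?num_real// -[leRHS]real_normK ?num_real//.
  rewrite lerXn2r ?nnegrE// norm_div_ge1// lerDl.
  by rewrite mulr_ge0 ?addr_ge0// ltW.
have trunc_cvg n k : (\int[mu]_(t in D) trunc_power P V n k N.+1%:R^-1 t) @[N --> \oo] --> m n k.
  (* By [trunc_power_dist], [e * h] bounds the distance from a monomial to its truncation, so the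
     integrals differ from [m n k] by at most [e * L h]. *)
  pose h : X -> R := fun z => n%:R * (`|(sval z).1| ^+ n + `|(sval z).1| ^+ n.+1).
  have Sh : S h.
    apply: SZ; apply: SD.
      apply: dominated_le (dominated_monomial n 0) _ => z.
      by rewrite expr0 mulr1 normrX normr_id -normrX.
    apply: dominated_le (dominated_monomial n.+1 0) _ => z.
    by rewrite expr0 mulr1 normrX normr_id -normrX.
  have bound N : `|m n k - \int[mu]_(t in D) trunc_power P V n k N.+1%:R^-1 t|
      <= N.+1%:R^-1 * L h.
    have e0 : 0 < N.+1%:R^-1 :> R by rewrite invr_gt0.
    rewrite (trunc_integral n k _ e0).2 -(LF _ _ (poly_value_monomial n k)) -LZ//.
    apply: (form_dist SD SZ LD LZ L_ge0 (dominated_monomial n k) (Sf n k _ e0) (SZ _ _ Sh)) => z.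
    rewrite /f -mulrBl normrM -[leRHS]mulr1 ler_pM//.
      exact: trunc_power_dist (ltW e0).
    have /andP[z0 z1] := svalP z.
    by rewrite normrX ger0_norm// exprn_ile1.
  apply/cvgrPdist_le => e e0; near=> N.
  apply: le_trans (bound N) _; rewrite mulrC -ler_pdivlMr ?invr_gt0// invrK.
  near: N; exists (Num.bound (L h / e)) => // N /= hN.
  have L0 : 0 <= L h by apply: L_ge0 => // z; rewrite mulr_ge0 ?addr_ge0 ?exprn_ge0.
  rewrite mulrC -ler_pdivrMr//; have /archi_boundP/ltW/le_trans : 0 <= L h / e.
    by rewrite divr_ge0// ltW.
  by apply; rewrite ler_nat (leq_trans hN).
have trunc_int n k e (e0 : 0 < e) := (trunc_integral n k e e0).1.
exists (D `&` finite_part P), (xcoord P), V; split=> //.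
- by apply: measurableI => //; exact: measurable_finite_part.
- exact: measurable_xcoord.
- exact: (moment_finite_part mD mP mV P_le1 V01 D_fin trunc_int trunc_le trunc_cvg).
Unshelve. all: by end_near.
Qed.

End MomentProblem.

(** * Complex integrals *)

Section RealAndImaginaryParts.
Variable R : realType.
Implicit Types z w : R[i].

Lemma ReD z w : complex.Re (z + w) = complex.Re z + complex.Re w.
Proof. by case: z; case: w. Qed.

Lemma ImD z w : complex.Im (z + w) = complex.Im z + complex.Im w.
Proof. by case: z; case: w. Qed.

Lemma ReB z w : complex.Re (z - w) = complex.Re z - complex.Re w.
Proof. by case: z; case: w. Qed.

Lemma ImB z w : complex.Im (z - w) = complex.Im z - complex.Im w.
Proof. by case: z; case: w. Qed.

Lemma ReM z w :
  complex.Re (z * w) = complex.Re z * complex.Re w - complex.Im z * complex.Im w.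
Proof. by case: z; case: w. Qed.

Lemma ImM z w :
  complex.Im (z * w) = complex.Re z * complex.Im w + complex.Im z * complex.Re w.
Proof. by case: z; case: w. Qed.

Lemma Re_sum I (s : seq I) (F : I -> R[i]) :
  complex.Re (\sum_(i <- s) F i) = \sum_(i <- s) complex.Re (F i).
Proof. exact: (big_morph (@complex.Re R) ReD). Qed.

Lemma Im_sum I (s : seq I) (F : I -> R[i]) :
  complex.Im (\sum_(i <- s) F i) = \sum_(i <- s) complex.Im (F i).
Proof. exact: (big_morph (@complex.Im R) ImD). Qed.

Lemma Re_scale (x : R) z : complex.Re (x%:C * z) = x * complex.Re z.
Proof. by case: z => u v /=; rewrite mul0r subr0. Qed.

Lemma Im_scale (x : R) z : complex.Im (x%:C * z) = x * complex.Im z.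
Proof. by case: z => u v /=; rewrite mul0r addr0. Qed.

Lemma complex_coordinates z :
  z = (complex.Re z)%:C + 'i * (complex.Im z)%:C /\
  conjc z = (complex.Re z)%:C - 'i * (complex.Im z)%:C.
Proof.
by split; case: z => a b; apply/eqP; rewrite eq_complex /=; apply/andP; split;
  apply/eqP; ring.
Qed.

Lemma im_sqr : 'i * 'i = -1 :> R[i].
Proof. by rewrite -expr2 sqr_i. Qed.

End RealAndImaginaryParts.

(** * Borel sets of the complex plane *)

Section BorelComplex.
Variable R : realType.
Implicit Types (z w : R[i]) (A : set R[i]).

Lemma norm_real_complex (x : R) : `|x%:C| = `|x|%:C.
Proof. by rewrite normc_def /= expr0n addr0 sqrtr_sqr. Qed.

Lemma norm_im : `|'i : R[i]| = 1.
Proof. by rewrite normc_def /= expr0n expr1n add0r sqrtr1. Qed.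

Lemma normc_ge_Im z : `|complex.Im z|%:C <= `|z|.
Proof. by have := normc_ge_Re (z * 'i); rewrite ReiNIm normrN normrM norm_im mulr1. Qed.

Lemma normc_le_ReIm z : `|z| <= (`|complex.Re z| + `|complex.Im z|)%:C.
Proof.
rewrite {1}[z]complexE rmorphD (le_trans (ler_normD _ _))//.
by rewrite normrM norm_im mul1r !norm_real_complex.
Qed.

(** Boxes and discs define the same topology, as [|Re z|] and [|Im z|] are at most [|z|], itself at
    most their sum. The radius of a ball is a positive element of [R[i]], hence a real number. *)
Lemma open_boxP A : (@open R[i]^o A) <-> forall z, A z ->
  exists2 e : R, 0 < e & forall w, `|complex.Re (z - w)| < e ->
    `|complex.Im (z - w)| < e -> A w.
Proof.
rewrite openE; split=> [Aopen z /Aopen|Abox z Az].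
  move=> /nbhs_ballP [[e ei] /=]; rewrite ltcE /= => /andP[/eqP ei0 e0] eA.
  exists (e / 2); first by rewrite divr_gt0.
  move=> w re im; apply: eA; rewrite -ball_normE /=.
  apply: le_lt_trans (normc_le_ReIm _) _; rewrite ltcE /= ei0 eqxx /=; lra.
have [e e0 eA] := Abox z Az.
apply/nbhs_ballP; exists e%:C; first by rewrite /= ltcR.
move=> w; rewrite -ball_normE /= => zw; apply: eA; rewrite -ltcR.
  exact: le_lt_trans (normc_ge_Re _) zw.
exact: le_lt_trans (normc_ge_Im _) zw.
Qed.

Lemma measurable_open_box (A : set (borelC R)) : (forall z, A z ->
  exists2 e : R, 0 < e & forall w, `|complex.Re (z - w)| < e ->
    `|complex.Im (z - w)| < e -> A w) -> measurable A.
Proof. by move=> h; apply: sub_sigma_algebra; apply/open_boxP. Qed.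

Lemma measurable_Re : measurable_fun setT (fun z : borelC R => complex.Re z).
Proof.
apply: (measurability _ (RGenOInfty.measurableE R)) => _ [_ [a ->] <-].
rewrite setTI; apply: measurable_open_box => z; rewrite /= !in_itv /= !andbT => az.
exists (complex.Re z - a); first by rewrite subr_gt0.
by move=> w; rewrite ReB in_itv /= andbT => /ltr_normlP[]; lra.
Qed.

Lemma measurable_Im : measurable_fun setT (fun z : borelC R => complex.Im z).
Proof.
apply: (measurability _ (RGenOInfty.measurableE R)) => _ [_ [a ->] <-].
rewrite setTI; apply: measurable_open_box => z; rewrite /= !in_itv /= !andbT => az.
exists (complex.Im z - a); first by rewrite subr_gt0.
by move=> w _; rewrite ImB in_itv /= andbT => /ltr_normlP[]; lra.
Qed.

Lemma measurable_strip (r : R) : measurable (strip r : set (borelC R)).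
Proof.
rewrite (_ : strip r = setT `&` (fun z : borelC R => `|complex.Im z|) @^-1` `]-oo, r]).
  apply: measurableT_comp => //; exact: measurable_Im.
by rewrite setTI; apply/seteqP; split=> z; rewrite /= in_itv.
Qed.

(** An open set is the countable union of the boxes with rational centre and radius that it
    contains, and the preimage of a box is measurable. *)
Lemma measurable_to_borelC d (T : measurableType d) (f g : T -> R) :
  measurable_fun setT f -> measurable_fun setT g ->
  measurable_fun setT (fun t => (f t +i* g t) : borelC R).
Proof.
move=> mf mg; apply: (@measurability _ _ T (borelC R) _ _ (@open R[i]^o)) => // _ [A Aopen <-].
rewrite setTI; move/open_boxP: Aopen => Abox.
pose box (c : rat * rat * rat) : set T :=
  [set t | ratr c.1.1 - ratr c.2 < f t < ratr c.1.1 + ratr c.2] `&`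
  [set t | ratr c.1.2 - ratr c.2 < g t < ratr c.1.2 + ratr c.2].
pose good (c : rat * rat * rat) := forall w, `|ratr c.1.1 - complex.Re w| < ratr c.2 ->
  `|ratr c.1.2 - complex.Im w| < ratr c.2 -> A w.
rewrite (_ : _ @^-1` A = \bigcup_c (if `[< good c >] then box c else set0)).
  apply: countable_bigcupT_measurable => // c; case: ifP => // _.
  rewrite (_ : box c = (setT `&` f @^-1` `]ratr c.1.1 - ratr c.2, ratr c.1.1 + ratr c.2[)
    `&` (setT `&` g @^-1` `]ratr c.1.2 - ratr c.2, ratr c.1.2 + ratr c.2[)); last first.
    by rewrite !setTI; apply/seteqP; split=> t; rewrite /= !in_itv.
  by apply: measurableI; [apply: mf|apply: mg].
apply/seteqP; split=> t /=.
  move=> /Abox[e e0 eA].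
  (* With a radius between [e / 4] and [e / 2] and a centre within [e / 4] in each coordinate, the
     box contains the point and stays within [e] of it. *)
  have /rat_in_itvoo[q] : e / 4 < e / 2 by lra.
  rewrite in_itv /= => /andP[q1 q2].
  have /rat_in_itvoo[x] : f t - e / 4 < f t by lra.
  rewrite in_itv /= => /andP[x1 x2].
  have /rat_in_itvoo[y] : g t - e / 4 < g t by lra.
  rewrite in_itv /= => /andP[y1 y2].
  exists (x, y, q) => //; rewrite asboolT.
    by split=> /=; apply/andP; split; lra.
  move=> w /= /ltr_normlP[h1 h2] /ltr_normlP[h3 h4]; apply: eA.
    by rewrite ReB /=; apply/ltr_normlP; split; lra.
  by rewrite ImB /=; apply/ltr_normlP; split; lra.
move=> [c _]; case: ifP => // /asboolP cA [/= /andP[f1 f2] /andP[g1 g2]].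
by apply: cA; apply/ltr_normlP; split=> /=; lra.
Qed.

End BorelComplex.

Section RestrictedMeasure.
Context d (T : measurableType d) (R : realType).
Variables (mu : {measure set T -> \bar R}) (D : set T) (mD : measurable D).
Implicit Type f : T -> \bar R.

Let nu : {measure set T -> \bar R} := mrestr mu mD.

Let nuD (A : set T) : measurable A -> A `<=` D -> nu A = mu A.
Proof. by move=> _ AD; rewrite /nu /= /mrestr setIidl. Qed.

Let nuC : nu (~` D) = 0%E.
Proof. by rewrite /nu /= /mrestr setICl measure0. Qed.

Lemma integrable_mrestr f : measurable_fun setT f -> mu.-integrable D f ->
  nu.-integrable setT f.
Proof.
move=> mf /integrableP[_ fi]; apply/integrableP; split=> //.
rewrite (ge0_negligible_integral (measurableC mD) _ _ _ nuC)//; last first.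
  exact: measurableT_comp.
by rewrite setTD setCK (eq_measure_integral mu).
Qed.

Lemma integral_mrestr f : measurable_fun setT f -> mu.-integrable D f ->
  (\int[nu]_x f x = \int[mu]_(x in D) f x)%E.
Proof.
move=> mf fi.
rewrite (negligible_integral (measurableC mD) _ (integrable_mrestr mf fi) nuC)//.
by rewrite setTD setCK (eq_measure_integral mu).
Qed.

End RestrictedMeasure.

Section ComplexIntegral.
Context d (T : measurableType d) (R : realType).
Variables (mu : {measure set T -> \bar R}) (D : set T).
Hypothesis mD : measurable D.
Implicit Types (f g : T -> R[i]) (c : R[i]).

(** Integrability and value are kept together, so that each linearity lemma carries both. *)
Definition has_cintegral f c := cintegrable mu D f /\ cintegral mu D f = c.

Lemma eq_has_cintegral f g c : (forall t, D t -> f t = g t) ->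
  has_cintegral f c -> has_cintegral g c.
Proof.
move=> fg [[iRe iIm] <-]; split.
  by split; [move: iRe|move: iIm]; apply: eq_integrable => // t /set_mem /fg ->.
by congr (_ +i* _); apply: eq_Rintegral => t /set_mem /fg ->.
Qed.

Lemma has_cintegralD f g c c' : has_cintegral f c -> has_cintegral g c' ->
  has_cintegral (fun t => f t + g t) (c + c').
Proof.
move=> [[fRe fIm] <-] [[gRe gIm] <-].
split.
  split.
    by apply: eq_integrable (integrableD mD fRe gRe) => // t _; rewrite ReD EFinD.
  by apply: eq_integrable (integrableD mD fIm gIm) => // t _; rewrite ImD EFinD.
rewrite /cintegral; under eq_Rintegral do rewrite ReD.
under [X in _ +i* X]eq_Rintegral do rewrite ImD.
by rewrite !RintegralD.
Qed.

Lemma has_cintegralZ (a : R[i]) f c : has_cintegral f c ->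
  has_cintegral (fun t => a * f t) (a * c).
Proof.
move=> [[fRe fIm] <-].
pose x := complex.Re a; pose y := complex.Im a.
have ZRe (b : R) := integrableZl mD b fRe; have ZIm (b : R) := integrableZl mD b fIm.
split.
  split.
    apply: eq_integrable (integrableB mD (ZRe x) (ZIm y)) => // t _.
    by rewrite ReM EFinB !EFinM.
  apply: eq_integrable (integrableD mD (ZIm x) (ZRe y)) => // t _.
  by rewrite ImM EFinD !EFinM.
rewrite /cintegral; under eq_Rintegral do rewrite ReM.
under [X in _ +i* X]eq_Rintegral do rewrite ImM.
rewrite RintegralB ?RintegralD ?RintegralZl//; first by case: (a).
all: by [exact: ZRe|exact: ZIm].
Qed.

Lemma has_cintegral_sum I (s : seq I) (F : I -> T -> R[i]) (c : I -> R[i]) :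
  (forall i, has_cintegral (F i) (c i)) ->
  has_cintegral (fun t => \sum_(i <- s) F i t) (\sum_(i <- s) c i).
Proof.
move=> Fc; elim: s => [|i s IH].
  rewrite big_nil; apply: (eq_has_cintegral (f := fun=> 0)); first by move=> t _; rewrite big_nil.
  split; last by rewrite /cintegral /Rintegral !integral0.
  by split; exact: integrable0.
rewrite big_cons; apply: (eq_has_cintegral (f := fun t => F i t + \sum_(i <- s) F i t)).
  by move=> t _; rewrite big_cons.
exact: has_cintegralD.
Qed.

Lemma has_cintegral_ge0 f c : has_cintegral f c -> (forall t, D t -> 0 <= f t) -> 0 <= c.
Proof.
move=> [_ <-] f_ge0; rewrite lecE /=; apply/andP; split.
  rewrite (@eq_Rintegral _ _ _ mu D (fun=> 0)); first by rewrite /Rintegral integral0.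
  by move=> t /set_mem /f_ge0; rewrite lecE => /andP[/eqP].
by apply: Rintegral_ge0 => t /f_ge0; rewrite lecE => /andP[].
Qed.

End ComplexIntegral.

Section QuadraticForms.
Variable R : realType.
Implicit Types (alpha : nat -> nat -> R[i]) (t : nat -> nat -> nat -> nat -> R[i]).

Lemma quad_formE t alpha N :
  (forall m n, (N <= m)%N || (N <= n)%N -> alpha m n = 0) ->
  quad_form t alpha = \sum_(m < N) \sum_(n < N) \sum_(k < N) \sum_(l < N)
    alpha m n * conjc (alpha k l) * t m n k l.
Proof.
move=> alpha0; rewrite /quad_form.
pose s := [seq (m, n) | m <- iota 0 N, n <- iota 0 N].
have s_uniq : uniq s by apply: allpairs_uniq => [||[? ?] [? ?]]//; exact: iota_uniq.
have in_s p : (p \in s) = (p.1 < N)%N && (p.2 < N)%N.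
  case: p => m n; apply/allpairsP/andP => /= [[[m' n'] /= []]|[mN nN]].
    by rewrite !mem_iota !add0n /= => mN nN [-> ->].
  by exists (m, n); rewrite !mem_iota !add0n.
have out_s p : p \notin s -> alpha p.1 p.2 = 0.
  by rewrite in_s negb_and -!leqNgt => /alpha0.
have r_uniq : uniq [seq (p, q) | p <- s, q <- s].
  by apply: allpairs_uniq => // -[? ?] [? ?].
rewrite (fsbigE [seq (p, q) | p <- s, q <- s]); last 3 first.
- exact: r_uniq.
- by [].
- move=> [p q] _; have [ps|/out_s ->] := boolP (p \in s); last by rewrite !mul0r.
  have [qs|/out_s ->] := boolP (q \in s); last by rewrite conjc0 mulr0 mul0r.
  by rewrite allpairs_f.
under eq_bigl do rewrite in_setT.
have sum_iota (F : nat -> R[i]) : \sum_(i <- iota 0 N) F i = \sum_(i < N) F i.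
  by rewrite -(big_mkord xpredT) /index_iota subn0.
have sum_s (F : nat * nat -> R[i]) : \sum_(p <- s) F p = \sum_(m < N) \sum_(n < N) F (m : nat, n : nat).
  by rewrite /s big_allpairs_dep sum_iota; apply: eq_bigr => m _; rewrite sum_iota.
rewrite big_allpairs_dep sum_s; apply: eq_bigr => m _; apply: eq_bigr => n _.
by rewrite sum_s.
Qed.

Lemma fin_supp_bounded alpha : fin_supp alpha ->
  exists N, forall m n, (N <= m)%N || (N <= n)%N -> alpha m n = 0.
Proof.
move=> /finite_seqP[s sE]; exists (\max_(p <- s) (p.1 + p.2)).+1 => m n mn.
apply/eqP/negPn/negP => amn.
have ps : (m, n) \in s by have : [set` s] (m, n) by rewrite -sE.
have : (m + n <= \max_(p <- s) (p.1 + p.2))%N.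
  exact: (@leq_bigmax_seq _ s xpredT (fun p => (p.1 + p.2)%N) (m, n)).
by move/leq_ltn_trans => /(_ _ (ltnSn _)); case/orP: mn => h; rewrite ltnNge (leq_trans h)// ?leq_addr ?leq_addl.
Qed.

End QuadraticForms.

(** * From conjugate coordinates to real ones and back *)

Section CoordinateChange.
Variables (F : numFieldType) (i x y : F).

(** The double sum factors as [(zb + z) ^ m (zb - z) ^ n = (2 x) ^ m (- 2 i y) ^ n], and
    [i ^ n (- 2 i) ^ n = 2 ^ n], so that all powers of [2] cancel. *)
Lemma coordinates_of_conjugates m n : i * i = -1 ->
  x ^+ m * y ^+ n = i ^+ n / 2 ^+ (m + n) *
  \sum_(0 <= k < m.+1) \sum_(0 <= j < n.+1)
    (-1) ^+ j * 'C(m, k)%:R * 'C(n, j)%:R *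
    ((x + i * y) ^+ (k + j) * (x - i * y) ^+ (m - k + (n - j))).
Proof.
move=> i2; set z := x + i * y; set zb := x - i * y.
have -> : \sum_(0 <= k < m.+1) \sum_(0 <= j < n.+1)
    (-1) ^+ j * 'C(m, k)%:R * 'C(n, j)%:R * (z ^+ (k + j) * zb ^+ (m - k + (n - j))) =
    (zb + z) ^+ m * (zb - z) ^+ n.
  rewrite !exprDn mulr_suml big_mkord; apply: eq_bigr => k _.
  rewrite big_mkord mulr_sumr; apply: eq_bigr => j _.
  rewrite (exprNn z) !exprD -!(mulr_natr (_ * _)).
  move: ((-1) ^+ j) (z ^+ k) (z ^+ j) (zb ^+ (m - k)) (zb ^+ (n - j)) => e zk zj zbk zbj.
  by ring.
have -> : zb + z = 2 * x by rewrite /z /zb; ring.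
have -> : zb - z = - 2 * (i * y) by rewrite /z /zb; ring.
rewrite !exprMn exprD invfM.
have two n' : 2 ^+ n' * (2 ^+ n')^-1 = 1 :> F by rewrite divff// expf_neq0// pnatr_eq0.
transitivity (x ^+ m * y ^+ n * ((i * i) ^+ n * (- 2) ^+ n * (2 ^+ n)^-1 * (2 ^+ m * (2 ^+ m)^-1))).
  by rewrite i2 -exprMn mulrNN mul1r !two !mulr1.
rewrite exprMn.
move: (x ^+ m) (y ^+ n) (i ^+ n) ((- 2) ^+ n) (2 ^+ n)^-1 (2 ^+ m) (2 ^+ m)^-1 => X Y I A B C D.
by ring.
Qed.

Lemma conjugates_of_coordinates m n :
  (x + i * y) ^+ m * (x - i * y) ^+ n =
  \sum_(0 <= p < m.+1) \sum_(0 <= q < n.+1)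
    'C(m, p)%:R * 'C(n, q)%:R * (-1) ^+ (n - q)
    * i ^+ (m - p + (n - q)) * (x ^+ (p + q) * y ^+ (m - p + (n - q))).
Proof.
rewrite addrC [x - _]addrC !exprDn mulr_suml big_mkord; apply: eq_bigr => p _.
rewrite mulr_sumr big_mkord; apply: eq_bigr => q _.
rewrite (exprNn (i * y)) !exprMn !exprD -!(mulr_natr (_ * _)).
move: ((-1) ^+ _) (x ^+ p) (x ^+ q) (y ^+ (m - p)) (y ^+ (n - q)) (i ^+ (m - p))
  (i ^+ (n - q)) => e xp xq yp yq ip iq.
by ring.
Qed.

End CoordinateChange.

(** * The moment problem in the strip *)

Section StripMoments.
Variable R : realType.

Definition xyC (m n : nat) (z : R[i]) : R[i] :=
  (complex.Re z)%:C ^+ m * (complex.Im z)%:C ^+ n.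

Lemma conjc_xyC m n z : conjc (xyC m n z) = xyC m n z.
Proof.
suff -> : xyC m n z = (complex.Re z ^+ m * complex.Im z ^+ n)%:C by exact: conjc_real.
by rewrite /xyC [RHS]rmorphM !rmorphXn.
Qed.

(** * Necessity of the conditions *)

Section Necessity.
Variables (r : R) (a : nat -> nat -> R[i]) (sigma : {measure set (borelC R) -> \bar R}).
Hypothesis sigma_sol : strip_moment_solution r a sigma.

Let D : set (borelC R) := strip r.
Let mD : measurable D. Proof. exact: measurable_strip. Qed.

Lemma has_cintegral_monoC m n : has_cintegral sigma D (monoC m n) (a m n).
Proof. exact: sigma_sol.2. Qed.

Lemma has_cintegral_xyC m n : has_cintegral sigma D (xyC m n) (s_of a m n).
Proof.
rewrite /s_of; apply: (eq_has_cintegral mD); last first.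
  apply: has_cintegralZ => //; apply: has_cintegral_sum => // k.
  apply: has_cintegral_sum => // j; apply: has_cintegralZ => //.
  exact: has_cintegral_monoC.
move=> z _ /=; rewrite /xyC (coordinates_of_conjugates _ _ _ _ (im_sqr R)).
have [<- <-] := complex_coordinates z.
by [].
Qed.

Lemma necessity_conjugate m n : a m n =
  \sum_(0 <= p < m.+1) \sum_(0 <= q < n.+1)
    'C(m, p)%:R * 'C(n, q)%:R * (-1) ^+ (n - q)
    * (0 +i* 1) ^+ (m - p + (n - q)) * s_of a (p + q) (m - p + (n - q)).
Proof.
have [_ <-] := has_cintegral_monoC m n.
suff [] : has_cintegral sigma D (monoC m n) (\sum_(0 <= p < m.+1) \sum_(0 <= q < n.+1)
    'C(m, p)%:R * 'C(n, q)%:R * (-1) ^+ (n - q)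
    * (0 +i* 1) ^+ (m - p + (n - q)) * s_of a (p + q) (m - p + (n - q))) by [].
apply: (eq_has_cintegral mD); last first.
  apply: has_cintegral_sum => // p; apply: has_cintegral_sum => // q.
  apply: has_cintegralZ => //; exact: has_cintegral_xyC.
move=> z _ /=; have [zE zbE] := complex_coordinates z.
by rewrite /monoC zbE {2}zE conjugates_of_coordinates.
Qed.

(** The form is the integral of [w |P|^2], where [P] is the polynomial in [x] and [y] with
    coefficients [alpha]; the monomials are real, so conjugation only affects the coefficients. *)
Lemma necessity_quad_form (c : nat -> nat -> R[i]) (w : R[i] -> R[i]) alpha :
  (forall m n, has_cintegral sigma D (fun z => w z * xyC m n z) (c m n)) ->
  (forall z, D z -> 0 <= w z) -> fin_supp alpha ->
  0 <= quad_form (fun m n k l => c (m + k)%N (n + l)%N) alpha.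
Proof.
move=> hc w0 /fin_supp_bounded[N alphaN]; rewrite (quad_formE _ alphaN).
pose P z := \sum_(m < N) \sum_(n < N) alpha m n * xyC m n z.
suff h : has_cintegral sigma D (fun z => w z * (P z * conjc (P z)))
    (\sum_(m < N) \sum_(n < N) \sum_(k < N) \sum_(l < N)
    alpha m n * conjc (alpha k l) * c (m + k)%N (n + l)%N).
  apply: (has_cintegral_ge0 h) => z Dz.
  by rewrite -sqr_normc mulr_ge0 ?w0// exprn_ge0.
apply: (eq_has_cintegral mD); last first.
  apply: has_cintegral_sum => // m; apply: has_cintegral_sum => // n.
  apply: has_cintegral_sum => // k; apply: has_cintegral_sum => // l.
  apply: has_cintegralZ => //; exact: hc.
move=> z _ /=; rewrite /P rmorph_sum /= mulr_suml mulr_sumr; apply: eq_bigr => m _.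
rewrite mulr_suml mulr_sumr; apply: eq_bigr => n _.
rewrite mulr_sumr mulr_sumr; apply: eq_bigr => k _.
rewrite rmorph_sum /= mulr_sumr mulr_sumr; apply: eq_bigr => l _.
rewrite rmorphM /= conjc_xyC /xyC !exprD.
move: (w z) (alpha m n) (conjc (alpha k l)) (_%:C ^+ m) (_%:C ^+ n) (_%:C ^+ k) (_%:C ^+ l).
by move=> *; ring.
Qed.

Lemma necessity : 0 < r ->
  [/\ forall alpha : nat -> nat -> R[i], fin_supp alpha ->
        0 <= quad_form (fun m n k l => s_of a (m + k) (n + l)) alpha,
      forall alpha : nat -> nat -> R[i], fin_supp alpha ->
        0 <= quad_form (fun m n k l =>
               r%:C ^+ 2 * s_of a (m + k) (n + l)
               - s_of a (m + k) (n + l + 2)) alpha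
    & forall m n : nat,
        a m n = \sum_(0 <= p < m.+1) \sum_(0 <= q < n.+1)
          'C(m, p)%:R * 'C(n, q)%:R * (-1) ^+ (n - q)
          * (0 +i* 1) ^+ (m - p + (n - q)) * s_of a (p + q) (m - p + (n - q))].
Proof.
move=> r0; split; last exact: necessity_conjugate.
  move=> alpha fa; apply: (necessity_quad_form (w := fun=> 1)) => // m n.
  apply: (eq_has_cintegral mD) (has_cintegral_xyC m n) => z _; by rewrite mul1r.
move=> alpha fa.
(* The weight [r^2 - y^2] is non-negative on the strip, and its term [y^2] shifts the second index
   by [2]. *)
apply: (necessity_quad_form (c := fun m n => r%:C ^+ 2 * s_of a m n - s_of a m (n + 2))
  (w := fun z => (r ^+ 2 - complex.Im z ^+ 2)%:C)) => // [m n|z Dz].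
  rewrite -mulN1r; apply: (eq_has_cintegral mD); last first.
    apply: has_cintegralD => //; apply: has_cintegralZ => //; exact: has_cintegral_xyC.
  move=> z _ /=; rewrite /xyC rmorphB !rmorphXn /= exprD.
  move: (_%:C ^+ 2) (_%:C ^+ 2) (_%:C ^+ m) (_%:C ^+ n) => *; by ring.
by rewrite lecR subr_ge0 -[leLHS]real_normK ?num_real// lerXn2r ?nnegrE// ltW.
Qed.

End Necessity.

(** * Sufficiency: construction of the measure *)

Section Sufficiency.
Variables (r : R) (a : nat -> nat -> R[i]).
Hypothesis r0 : 0 < r.
Hypothesis a_sqr : forall alpha : nat -> nat -> R[i], fin_supp alpha ->
  0 <= quad_form (fun m n k l => s_of a (m + k) (n + l)) alpha.
Hypothesis a_itv : forall alpha : nat -> nat -> R[i], fin_supp alpha ->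
  0 <= quad_form (fun m n k l => r%:C ^+ 2 * s_of a (m + k) (n + l)
    - s_of a (m + k) (n + l + 2)) alpha.
Hypothesis a_xy : forall m n : nat,
  a m n = \sum_(0 <= p < m.+1) \sum_(0 <= q < n.+1)
    'C(m, p)%:R * 'C(n, q)%:R * (-1) ^+ (n - q)
    * (0 +i* 1) ^+ (m - p + (n - q)) * s_of a (p + q) (m - p + (n - q)).

Lemma mom_mul (f : nat -> R) (p q : {poly R}) N : (size p <= N)%N -> (size q <= N)%N ->
  mom f (p * q) = \sum_(i < N) \sum_(j < N) p`_i * q`_j * f (i + j)%N.
Proof.
have polyE (u : {poly R}) : (size u <= N)%N -> u = \sum_(i < N) u`_i *: 'X^i.
  move=> sN; rewrite -poly_def; apply/polyP => i; rewrite coef_poly.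
  by case: ltnP => // Ni; rewrite nth_default// (leq_trans sN).
have momZ c (u : {poly R}) : mom f (c *: u) = c * mom f u by exact: scalarZ.
move=> /polyE pE /polyE qE; rewrite {1}pE {1}qE mulr_suml raddf_sum.
apply: eq_bigr => i _; rewrite mulr_sumr raddf_sum; apply: eq_bigr => j _.
by rewrite /= -scalerAl -scalerAr scalerA -exprD momZ momXn.
Qed.

Lemma bimom_sqr (f : nat -> nat -> R) (q b : {poly R}) N :
  (size q <= N)%N -> (size b <= N)%N ->
  bimom f (q ^+ 2) (b ^+ 2) = \sum_(m < N) \sum_(n < N) \sum_(k < N) \sum_(l < N)
    q`_m * b`_n * (q`_k * b`_l) * f (m + k)%N (n + l)%N.
Proof.
move=> qN bN; rewrite /bimom !expr2 (mom_mul _ qN qN).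
apply: eq_bigr => m _; rewrite [RHS]exchange_big /=; apply: eq_bigr => k _.
rewrite (mom_mul _ bN bN) mulr_sumr; apply: eq_bigr => n _.
by rewrite mulr_sumr; apply: eq_bigr => l _; rewrite !mulrA [q`_m * _ * _]mulrAC.
Qed.

(** The real coefficients [q_m b_n] are those of the product [q(x) b(y)]. Non-negativity in [R[i]]
    also says that the form is real, whence the second part. *)
Lemma quad_form_product (c : nat -> nat -> R[i]) (q b : {poly R}) :
  (forall alpha, fin_supp alpha ->
    0 <= quad_form (fun m n k l => c (m + k)%N (n + l)%N) alpha) ->
  0 <= bimom (fun i j => complex.Re (c i j)) (q ^+ 2) (b ^+ 2) /\
  bimom (fun i j => complex.Im (c i j)) (q ^+ 2) (b ^+ 2) = 0.
Proof.
pose N := maxn (size q) (size b).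
have qN : (size q <= N)%N by rewrite leq_maxl.
have bN : (size b <= N)%N by rewrite leq_maxr.
pose alpha m n : R[i] := (q`_m * b`_n)%:C.
have alphaN m n : (N <= m)%N || (N <= n)%N -> alpha m n = 0.
  move=> /orP[/(leq_trans qN)|/(leq_trans bN)] h; rewrite /alpha.
    by rewrite [q`_m]nth_default// mul0r.
  by rewrite [b`_n]nth_default// mulr0.
have alpha_fin : fin_supp alpha.
  apply: (@sub_finite_set _ _ (`I_N `*` `I_N)); last by apply: finite_setX.
  move=> [m n] /= amn; split; rewrite /= ltnNge; apply/negP => h.
    by rewrite alphaN ?h ?eqxx// in amn.
  by rewrite alphaN ?h ?orbT ?eqxx// in amn.
move=> /(_ _ alpha_fin); rewrite (quad_formE _ alphaN) lecE => /andP[/eqP imE reE].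
rewrite (bimom_sqr _ qN bN) (bimom_sqr _ qN bN); split.
  apply: le_trans reE _; rewrite Re_sum; apply: ler_sum => m _.
  rewrite Re_sum; apply: ler_sum => n _; rewrite Re_sum; apply: ler_sum => k _.
  rewrite Re_sum; apply: ler_sum => l _.
  by rewrite conjc_real -rmorphM /= Re_scale.
rewrite -[RHS]imE Im_sum; apply: eq_bigr => m _.
rewrite Im_sum; apply: eq_bigr => n _; rewrite Im_sum; apply: eq_bigr => k _.
rewrite Im_sum; apply: eq_bigr => l _.
by rewrite conjc_real -rmorphM /= Im_scale.
Qed.

Lemma poly_polarization (p : {poly R}) : p = 4^-1 *: ((p + 1) ^+ 2 - (p - 1) ^+ 2).
Proof.
have -> : (p + 1) ^+ 2 - (p - 1) ^+ 2 = 4 * p by ring.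
by apply/polyP => i; rewrite coefZ mulr_natl coefMn -(mulr_natl p`_i) mulKf// pnatr_eq0.
Qed.

(** By polarization every polynomial is a combination of two squares, so the values on products of
    squares determine all moments. *)
Lemma bimom_sqr_eq0 (f : nat -> nat -> R) :
  (forall q b : {poly R}, bimom f (q ^+ 2) (b ^+ 2) = 0) -> forall m n, f m n = 0.
Proof.
move=> f0 m n; rewrite -[f m n](momXn (f m)) -[mom _ _](momXn (fun i => mom (f i) 'X^n)).
rewrite -/(bimom f 'X^m 'X^n) [in X in bimom _ X _](poly_polarization 'X^m).
rewrite [in X in bimom _ _ X](poly_polarization 'X^n).
have bimomZr c q b : bimom f q (c *: b) = c * bimom f q b by exact: scalarZ.
have bimomBr q b b' : bimom f q (b - b') = bimom f q b - bimom f q b' by exact: raddfB.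
have bimomBl q q' b : bimom f (q - q') b = bimom f q b - bimom f q' b by exact: raddfB.
by rewrite bimomZ bimomZr bimomBl !bimomBr !f0 !subrr !mulr0.
Qed.

(** The imaginary parts define a functional that vanishes on products of squares, by the second part
    of [quad_form_product]. *)
Lemma s_of_real m n : s_of a m n = (complex.Re (s_of a m n))%:C.
Proof.
have -> : s_of a m n = complex.Re (s_of a m n) +i* complex.Im (s_of a m n) by case: s_of.
congr (_ +i* _); apply: (bimom_sqr_eq0 (f := fun m n => complex.Im (s_of a m n))) => q b.
exact: (quad_form_product q b a_sqr).2.
Qed.

Let s m n : R := complex.Re (s_of a m n).

Lemma s_sqr (q b : {poly R}) : 0 <= bimom s (q ^+ 2) (b ^+ 2).
Proof. exact: (quad_form_product q b a_sqr).1. Qed.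

Lemma s_itv (q b : {poly R}) : 0 <= bimom s (q ^+ 2) (((r ^+ 2)%:P - 'X^2) * b ^+ 2).
Proof.
have := (quad_form_product (c := fun m n => r%:C ^+ 2 * s_of a m n - s_of a m (n + 2)) q b a_itv).1.
congr (0 <= _); apply: eq_mom => i.
have momX2 (f : nat -> R) p : mom f ('X^2 * p) = mom (fun j => f (j + 2)%N) p.
  have sX : (size ('X^2 : {poly R}) <= (size p).+3)%N by rewrite size_polyXn.
  have sp : (size p <= (size p).+3)%N by rewrite -addn3 leq_addr.
  rewrite (mom_mul f sX sp).
  rewrite (bigD1 (inord 2))//= inordK// [X in _ + X]big1 ?addr0 => [|j j2]; last first.
    rewrite big1// => k _; rewrite coefXn; case: eqVneq => [e|_]; last by rewrite !mul0r.
    by move: j2; rewrite -val_eqE /= inordK// e eqxx.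
  rewrite (momE _ sp).
  by apply: eq_bigr => j _; rewrite coefXn eqxx mul1r addnC.
have momZ (f : nat -> R) c p : mom f (c *: p) = c * mom f p by exact: scalarZ.
have momB (f : nat -> R) p p' : mom f (p - p') = mom f p - mom f p' by exact: raddfB.
rewrite mulrBl mul_polyC momB momZ momX2 /mom mulr_sumr -sumrB.
apply: eq_bigr => j _; transitivity ((b ^+ 2)`_j * (r ^+ 2 * s i j - s i (j + 2)%N)).
  congr (_ * _); rewrite ReD -rmorphXn /= Re_scale.
  by rewrite /s; case: (s_of a i (j + 2)).
by ring.
Qed.

(** The affine map [(y + r) / (2 r)] from [[-r, r]] onto [[0, 1]]; [M] below collects the moments of
    [x ^ n t ^ k] with [t = tau(y)]. *)
Let tau : {poly R} := (2 * r)^-1 *: ('X + r%:P).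

Let M n k : R := mom (s n) (tau ^+ k).

Lemma mom_tau n (b : {poly R}) : mom (M n) b = mom (s n) (b \Po tau).
Proof.
rewrite comp_polyE raddf_sum; apply: eq_bigr => j _.
by rewrite [RHS]scalarZ.
Qed.

Lemma bimom_tau (q b : {poly R}) : bimom M q b = bimom s q (b \Po tau).
Proof. by apply: eq_mom => i; exact: mom_tau. Qed.

Lemma M_sqr (q b : {poly R}) : 0 <= bimom M (q ^+ 2) (b ^+ 2).
Proof. by rewrite bimom_tau rmorphXn s_sqr. Qed.

(** As [tau (1 - tau) = (r^2 - y^2) / (4 r^2)], this is [s_itv] up to a positive factor. *)
Lemma M_itv (q b : {poly R}) : 0 <= bimom M (q ^+ 2) ('X * (1 - 'X) * b ^+ 2).
Proof.
rewrite bimom_tau !comp_polyM comp_polyB comp_polyX comp_polyC -expr2.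
have -> : tau * (1 - tau) = ((2 * r)^-1 ^+ 2) *: ((r ^+ 2)%:P - 'X^2).
  have one : 1 = (2 * r)^-1 *: ((2 * r)%:P) :> {poly R}.
    by rewrite -mul_polyC -polyCM mulVf// mulf_neq0 ?gt_eqF.
  rewrite [X in _ * (X - _)]one /tau -scalerBr -scalerAl -scalerAr scalerA -expr2; congr (_ *: _).
  by rewrite polyCM polyCMn polyC_exp; ring.
have bimomZr c u v : bimom s u (c *: v) = c * bimom s u v by exact: scalarZ.
by rewrite -scalerAl bimomZr mulr_ge0 ?sqr_ge0// s_itv.
Qed.

Lemma has_cintegral_real d (T : measurableType d) (mu : {measure set T -> \bar R})
    (D : set T) (f : T -> R) (c : R) :
  mu.-integrable D (EFin \o f) -> \int[mu]_(t in D) f t = c ->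
  has_cintegral mu D (fun t => (f t)%:C) c%:C.
Proof.
move=> fi <-; split; first by split; [exact: fi|exact: integrable0].
by congr (_ +i* _); rewrite /Rintegral integral0.
Qed.

Lemma measurable_monoC m n :
  measurable_fun setT (fun z : borelC R => complex.Re (monoC m n z)) /\
  measurable_fun setT (fun z : borelC R => complex.Im (monoC m n z)).
Proof.
pose cmeas (f : borelC R -> R[i]) := measurable_fun setT (fun z => complex.Re (f z)) /\
  measurable_fun setT (fun z => complex.Im (f z)).
have cmeasM f g : cmeas f -> cmeas g -> cmeas (fun z => f z * g z).
  move=> [f1 f2] [g1 g2]; split.
    rewrite (_ : (fun z => _) = (fun z => complex.Re (f z) * complex.Re (g z) -
        complex.Im (f z) * complex.Im (g z))).
      by apply: measurable_funB; apply: measurable_funM.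
    by apply/funext => z; case: (f z); case: (g z).
  rewrite (_ : (fun z => _) = (fun z => complex.Re (f z) * complex.Im (g z) +
      complex.Im (f z) * complex.Re (g z))).
    by apply: measurable_funD; apply: measurable_funM.
  by apply/funext => z; case: (f z); case: (g z).
have cmeasX f k : cmeas f -> cmeas (fun z => f z ^+ k).
  move=> fm; elim: k => [|k IH].
    by split; under eq_fun do rewrite expr0; exact: measurable_cst.
  rewrite (_ : (fun z => _) = (fun z => f z * f z ^+ k)); first exact: cmeasM.
  by apply/funext => z; rewrite exprS.
apply: (cmeasM (fun z => z ^+ m) (fun z => conjc z ^+ n)); apply: cmeasX.
  by split; [exact: measurable_Re|exact: measurable_Im].
split.
  rewrite (_ : (fun z => _) = (fun z : borelC R => complex.Re z)); first exact: measurable_Re.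
  by apply/funext => -[].
rewrite (_ : (fun z => _) = (fun z : borelC R => - complex.Im z)).
  by apply: measurableT_comp => //; exact: measurable_Im.
by apply/funext => -[].
Qed.

Lemma sufficiency : exists sigma : {measure set (borelC R) -> \bar R},
  strip_moment_solution r a sigma.
Proof.
have [D [Xc [Vc [mD mX mV V01 intXV]]]] := moment_problem_itv01 M_sqr M_itv.
pose mu : {measure set (measurableTypeR R) -> \bar R} := @lebesgue_measure R.
pose Yc t := 2 * r * Vc t - r.
have mY : measurable_fun setT Yc.
  by apply: measurable_funB => //; apply: measurable_funM.
pose phi (t : measurableTypeR R) : borelC R := Xc t +i* Yc t.
have mphi : measurable_fun setT phi by exact: measurable_to_borelC.
have int_poly n (p : {poly R}) : has_cintegral mu D
    (fun t => (Xc t ^+ n * p.[Vc t])%:C) (mom (M n) p)%:C.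
  rewrite /mom rmorph_sum /=; apply: (eq_has_cintegral mD); last first.
    apply: (has_cintegral_sum mD) => i; rewrite rmorphM; apply: (has_cintegralZ mD).
    exact: has_cintegral_real (intXV n i).1 (intXV n i).2.
  move=> t _ /=; rewrite horner_coef mulr_sumr rmorph_sum; apply: eq_bigr => i _.
  by rewrite -rmorphM mulrCA.
have int_xy m n : has_cintegral mu D (fun t => xyC m n (phi t)) (s_of a m n).
  (* [p] is the inverse of [tau] under composition, and [Yc t] is its value at [Vc t]. *)
  pose p : {poly R} := (2 * r) *: 'X - r%:P.
  have -> : s_of a m n = (mom (M m) (p ^+ n))%:C.
    rewrite s_of_real mom_tau rmorphXn /= (_ : p \Po tau = 'X) ?momXn//.
    rewrite /p comp_polyB comp_polyZ comp_polyX comp_polyC scalerA divff ?scale1r ?addrK//.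
    by rewrite mulf_neq0// gt_eqF.
  apply: (eq_has_cintegral mD) (int_poly m (p ^+ n)) => t _.
  by rewrite /xyC /= -!rmorphXn -rmorphM horner_exp !hornerE.
have int_mono m n : has_cintegral mu D (fun t => monoC m n (phi t)) (a m n).
  rewrite a_xy; apply: (eq_has_cintegral mD); last first.
    apply: (has_cintegral_sum mD) => p; apply: (has_cintegral_sum mD) => q.
    by apply: (has_cintegralZ mD); exact: int_xy.
  move=> t _ /=; have [zE zbE] := complex_coordinates (phi t).
  by rewrite /monoC zbE {2}zE conjugates_of_coordinates.
(* Lebesgue measure is restricted to [D], then pushed forward by [phi]. As [phi] maps the whole line
   into the strip, the complement of the strip has empty preimage. *)
pose nu : {measure set (measurableTypeR R) -> \bar R} := mrestr mu mD.
have phi_strip t : strip r (phi t).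
  rewrite /strip /= /Yc; have /andP[V0 V1] := V01 t.
  have rV0 : 0 <= r * Vc t by rewrite mulr_ge0// ltW.
  have rV1 : r * Vc t <= r by rewrite ler_piMr// ltW.
  by rewrite ler_norml; apply/andP; split; lra.
have phi_pre : phi @^-1` strip r = setT.
  by apply/seteqP; split=> // t _; exact: phi_strip.
have push (f : borelC R -> R) : measurable_fun setT f ->
    mu.-integrable D (fun t => (f (phi t))%:E) ->
    (pushforward nu phi).-integrable (strip r) (EFin \o f) /\
    (\int[pushforward nu phi]_(z in strip r) (f z)%:E = \int[mu]_(t in D) (f (phi t))%:E)%E.
  move=> mf fi; have mfphi : measurable_fun setT (fun t => (f (phi t))%:E).
    by apply/measurable_EFinP; exact: measurableT_comp mf mphi.
  have mfE : measurable_fun setT (EFin \o f) by exact/measurable_EFinP.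
  have nui : nu.-integrable (phi @^-1` strip r) ((EFin \o f) \o phi).
    by rewrite phi_pre; exact: integrable_mrestr.
  split; first exact: integrable_pushforward (measurable_strip r).
  rewrite (integral_pushforward mphi mfE nui (measurable_strip r)) phi_pre.
  exact: integral_mrestr.
unshelve eexists (pushforward nu phi : {measure set (borelC R) -> \bar R}); first exact: mphi.
split.
  have <- : nu set0 = 0%E := measure0 nu.
  by rewrite -[set0]setCT -phi_pre preimage_setC.
move=> m n; have [mRe mIm] := measurable_monoC m n.
have [[iRe iIm] <-] := int_mono m n.
have [pRe eRe] := push _ mRe iRe; have [pIm eIm] := push _ mIm iIm.
by split; [split|rewrite /cintegral /Rintegral eRe eIm].
Qed.

End Sufficiency.
End StripMoments.

Theorem theorem4p1 (R : realType) (r : R) (a : nat -> nat -> R[i])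
    (hr : 0 < r) :
  (exists sigma : {measure set (borelC R) -> \bar R},
     strip_moment_solution r a sigma)
  <->
  [/\ forall alpha : nat -> nat -> R[i], fin_supp alpha ->
        0 <= quad_form (fun m n k l => s_of a (m + k) (n + l)) alpha,
      forall alpha : nat -> nat -> R[i], fin_supp alpha ->
        0 <= quad_form (fun m n k l =>
               r%:C ^+ 2 * s_of a (m + k) (n + l)
               - s_of a (m + k) (n + l + 2)) alpha
    & forall m n : nat,
        a m n = \sum_(0 <= p < m.+1) \sum_(0 <= q < n.+1)
          'C(m, p)%:R * 'C(n, q)%:R * (-1) ^+ (n - q)
          * (0 +i* 1) ^+ (m - p + (n - q)) * s_of a (p + q) (m - p + (n - q))].
Proof.
split=> [[sigma sol]|[a_sqr a_itv a_xy]]; first exact: (necessity sol hr).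
exact: (sufficiency hr a_sqr a_itv a_xy).
Qed.
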